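(* Let $n\ge1$. Consider the multiline process with $n$ lines, started from one of the following initial distributions (which are stationary for it): either, on $\mathbb{Z}_N$ with $q_1,\dots,q_n\in\{0,1,\dots,N\}$, the uniform distribution on the set of $x\in\{1,\infty\}^{\mathbb{Z}_N\times\{1,\dots,n\}}$ having exactly $q_m$ particles on line $m$ for each $m$; or, on $\mathbb{Z}$ with $\rho_1,\dots,\rho_n\in[0,1]$, the product distribution on $\{1,\infty\}^{\mathbb{Z}\times\{1,\dots,n\}}$ under which all $x_m(i)$ are independent with $\mathbb{P}(x_m(i)=1)=\rho_m$. Then the marginal law of each line of the process (i.e., for each $m\in\{1,\dots,n\}$, the law of the process of configurations on line $m$, as a process in time) is that of a TASEP (on $\mathbb{Z}_N$ or on $\mathbb{Z}$, respectively).
   Context: The multiline process with $n$ lines on $\mathbb{Z}$ (respectively on the cycle $\mathbb{Z}_N$ of integers mod $N$) is a continuous-time Markov process with state space $\{1,\infty\}^{\mathbb{Z}\times\{1,\dots,n\}}$ (respectively $\{1,\infty\}^{\mathbb{Z}_N\times\{1,\dots,n\}}$). For a state $x$, $x_m(i)$ is the value at site $i$ on line $m$; the value $1$ indicates a particle and $\infty$ a hole, with $1<\infty$. For a state $x$ and a site $i$, define $b_m=b_m(x,i)$, $m=0,\dots,n$, by $b_n=i$ and, for $m=n-1,\dots,0$, $b_m=b_{m+1}$ if $x_{m+1}(b_{m+1})=1$ and $b_m=b_{m+1}+1$ if $x_{m+1}(b_{m+1})=\infty$. Let $y=Y(x,i)$ be the state given, for each $m=1,\dots,n$, by $y_m(j)=x_m(j)$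 for $j\notin\{b_m-1,b_m\}$, $y_m(b_m-1)=\min\{x_m(b_m-1),x_m(b_m)\}$, $y_m(b_m)=\max\{x_m(b_m-1),x_m(b_m)\}$. Dynamics: bells ring at each site of the bottom line (line $n$) as independent Poisson processes of rate 1; when the bell at site $i$ of line $n$ rings, the state $x$ jumps to $Y(x,i)$. The TASEP on $\mathbb{Z}$ (or $\mathbb{Z}_N$) is the continuous-time Markov process on $\{1,\infty\}^{\mathbb{Z}}$ (or $\{1,\infty\}^{\mathbb{Z}_N}$) in which bells ring at each site as independent Poisson processes of rate 1, and when the bell at site $i$ rings, the values $u(i-1),u(i)$ are replaced by $\min\{u(i-1),u(i)\},\max\{u(i-1),u(i)\}$ respectively (so a particle at $i$ jumps to $i-1$ if there is a hole at $i-1$). *)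

(* Defs.v *)
From HB Require Import structures.
From mathcomp Require Import all_boot all_order all_algebra.
From mathcomp Require Import all_classical all_reals all_analysis.

Set Implicit Arguments.
Unset Strict Implicit.
Unset Printing Implicit Defensive.

Import Order.TTheory GRing.Theory Num.Theory.
Import numFieldNormedType.Exports.

Local Open Scope classical_set_scope.
Local Open Scope ring_scope.

(* The value set {1, oo} with 1 < oo is bool with its library order
   false < true: a particle (1) is false and a hole (oo) is true, so that the
   minimum and maximum of site values are Order.min and Order.max on bool. *)
Definition particle : bool := false.
Definition hole : bool := true.

(* The set of sites S carries the maps next : i |-> i + 1 and
   prev : i |-> i - 1; it is int, or the cycle 'I_N with ordS and ord_pred. *)

Definition next_int (i : int) : int := i + 1.
Definition prev_int (i : int) : int := i - 1.

Section Dynamics.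
Variables (S : choiceType) (next prev : S -> S).

Definition tasep_jump (b : S) (u : S -> bool) : S -> bool :=
  fun j => if j == b then Order.max (u (prev b)) (u b)
           else if j == prev b then Order.min (u (prev b)) (u b)
           else u j.

Variable n : nat.

(* Line m = 1, ..., n is the ordinal m - 1 : 'I_n.
   [bell_site x i m] is b_m(x, i) for m = 0, ..., n: the lines n, ..., m + 1,
   which are the ordinals n - 1, ..., m, are crossed in this order; see
   bell_site_bottom and bell_siteS for the recursion. *)
Definition bell_site (x : S * 'I_n -> bool) (i : S) (m : nat) : S :=
  foldr (fun (l : 'I_n) b => if x (b, l) == particle then b else next b)
    i (drop m (enum 'I_n)).

Lemma bell_site_bottom x i : bell_site x i n = i.
Proof. by rewrite /bell_site drop_oversize// size_enum_ord. Qed.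

Lemma bell_siteS x i (l : 'I_n) :
  bell_site x i l =
  if x (bell_site x i l.+1, l) == particle then bell_site x i l.+1
  else next (bell_site x i l.+1).
Proof.
by rewrite /bell_site (drop_nth l) ?size_enum_ord//= nth_ord_enum.
Qed.

Definition multiline_jump (i : S) (x : S * 'I_n -> bool) : S * 'I_n -> bool :=
  fun a => tasep_jump (bell_site x i a.2.+1) (fun j => x (j, a.2)) a.1.

End Dynamics.

Section GeneratedSigmaAlgebras.
Context {T : pointedType} {K : Type} {d : measure_display}
  {V : measurableType d}.

Definition g_sigma_family (D : set K) (f : K -> T -> V) : set (set T) :=
  <<s \bigcup_(k in D) g_sigma_algebra_preimage (f k) >>.

End GeneratedSigmaAlgebras.

Section Probability.
Context {R : realType} {d : measure_display} {T : measurableType d}.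
Variable P : probability T R.

Definition mutually_independent (J : eqType) (F : J -> set (set T)) : Prop :=
  forall (s : seq J) (E : J -> set T), uniq s ->
    (forall j, j \in s -> F j (E j)) ->
    P (\bigcap_(j in [set` s]) E j) = (\prod_(j <- s) P (E j))%E.

(* N t w is the number of bells in ]0, t]; times range over t >= 0 and the
   values of N at negative times are irrelevant. *)
Definition counting_path (N : R -> nat) : Prop :=
  [/\ N 0 = 0%N,
      (forall s t, 0 <= s -> s <= t -> (N s <= N t)%N) &
      forall t, 0 <= t -> \forall s \near t^'+, N s = N t].

(* Only s < t is used because poisson_pmf 0 is not a probability mass function;
   for s = t the increment is 0. *)
Definition rate1_poisson_process (N : R -> T -> nat) : Prop :=
  [/\ (forall t, 0 <= t -> measurable_fun setT (N t)),
      {ae P, forall w, counting_path (N ^~ w)},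
      (forall s t k, 0 <= s -> s < t ->
        P [set w | (N t w - N s w)%N = k] = (poisson_pmf (t - s) k)%:E) &
      (forall t : nat -> R, 0 <= t 0%N -> (forall k, t k <= t k.+1) ->
        mutually_independent (fun k : nat =>
          g_sigma_algebra_preimage (fun w => (N (t k.+1) w - N (t k) w)%N)))].

Definition rings_at (N : R -> nat) (t : R) : Prop :=
  0 < t /\ forall s, 0 <= s -> s < t -> (N s < N t)%N.

(* The path p in {1, oo}^L jumps exactly when a bell rings, from its left limit
   xm to jump i xm when the bell is that of i; limits are taken coordinatewise,
   as infinitely many bells ring in any time interval when S is infinite. *)
Definition follows_bells (S L : Type) (jump : S -> (L -> bool) -> (L -> bool))
    (N : S -> R -> nat) (p : R -> L -> bool) : Prop :=
  (forall t l, 0 <= t -> \forall s \near t^'+, p s l = p t l) /\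
  (forall t, 0 < t -> exists xm : L -> bool,
    [/\ (forall l, \forall s \near t^'-, p s l = xm l),
        (forall i, rings_at (N i) t -> p t = jump i xm) &
        ((forall i, ~ rings_at (N i) t) -> p t = xm)]).

(* X is a process on {1, oo}^L driven by independent rate 1 Poisson bells N i,
   i in S, which are also independent of the initial state X 0. *)
Definition bell_driven (S : choiceType) (L : Type)
    (jump : S -> (L -> bool) -> (L -> bool))
    (N : S -> R -> T -> nat) (X : R -> T -> L -> bool) : Prop :=
  [/\ (forall i, rate1_poisson_process (N i)),
      (forall t l, 0 <= t -> measurable_fun setT (fun w => X t w l)),
      mutually_independent (fun o : option S =>
        match o with
        | Some i => g_sigma_family [set t : R | 0 <= t] (N i)
        | None => g_sigma_family [set: L] (fun l w => X 0 w l)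
        end) &
      {ae P, forall w, follows_bells jump (fun i t => N i t w) (X ^~ w)}].

Definition is_multiline (S : choiceType) (next prev : S -> S) (n : nat) :=
  bell_driven (@multiline_jump S next prev n).

Definition is_tasep (S : choiceType) (prev : S -> S) :=
  bell_driven (tasep_jump prev).

End Probability.

(* The product sigma-algebra on paths indexed by the times t >= 0. *)
Definition path_sigma_algebra (R : realType) (L : Type) :
    set (set (R -> L -> bool)) :=
  g_sigma_family [set a : R * L | 0 <= a.1]
    (fun a (p : R -> L -> bool) => p a.1 a.2).

Definition same_law (R : realType) (L : Type)
    (d : measure_display) (T : measurableType d) (P : probability T R)
    (X : R -> T -> L -> bool)
    (d' : measure_display) (T' : measurableType d') (P' : probability T' R)
    (X' : R -> T' -> L -> bool) : Prop :=
  forall A, @path_sigma_algebra R L A ->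
    P [set w | A (X ^~ w)] = P' [set w | A (X' ^~ w)].

(* The initial law of U is not mentioned: same_law makes it that of Y 0. *)
Definition has_tasep_law (R : realType) (S : choiceType) (prev : S -> S)
    (d : measure_display) (T : measurableType d) (P : probability T R)
    (Y : R -> T -> S -> bool) : Prop :=
  exists (d' : measure_display) (T' : measurableType d')
    (P' : probability T' R) (N : S -> R -> T' -> nat)
    (U : R -> T' -> S -> bool),
    is_tasep P' prev N U /\ same_law P Y P' U.

Definition line_process (R T S : Type) (n : nat)
    (X : R -> T -> S * 'I_n -> bool) (m : 'I_n) : R -> T -> S -> bool :=
  fun t w i => X t w (i, m).

Definition cycle_configs (N n : nat) (q : 'I_n -> nat) :
    {set {ffun 'I_N * 'I_n -> bool}} :=
  [set x : {ffun 'I_N * 'I_n -> bool} |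
    [forall m, #|[set i : 'I_N | x (i, m) == particle]| == q m]].

Definition uniform_initial (R : realType) (d : measure_display)
    (T : measurableType d) (P : probability T R) (N n : nat)
    (q : 'I_n -> nat) (X0 : T -> 'I_N * 'I_n -> bool) : Prop :=
  forall x : {ffun 'I_N * 'I_n -> bool},
    P [set w | forall a, X0 w a = x a] =
    (if x \in cycle_configs N q then (#|cycle_configs N q|%:R)^-1 else 0)%:E.

Definition product_initial (R : realType) (d : measure_display)
    (T : measurableType d) (P : probability T R) (n : nat)
    (rho : 'I_n -> R) (X0 : T -> int * 'I_n -> bool) : Prop :=
  mutually_independent P (fun a : int * 'I_n =>
    g_sigma_algebra_preimage (fun w => X0 w a)) /\
  (forall i m, P [set w | X0 w (i, m) = particle] = (rho m)%:E).

(* Main.v *)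
Require Import Defs.
From HB Require Import structures.
From mathcomp Require Import all_boot all_order all_algebra perm finmap.
From mathcomp Require Import zify ring lra.
From mathcomp Require Import all_classical all_reals all_analysis.

(* The map (x, i) |-> (x', b_m), where i rings and x' is x with only the lines
   below line m updated, is a bijection of states times sites on a cycle, and it
   preserves the number of particles of each line, hence the stationary weights.
   So in discrete time, with i.i.d. uniform rings independent of the state, the
   sites b_m are again i.i.d. uniform and independent of line m.

   In continuous time, let the bells of line m ring at site j at the times when
   the bell of some i rings and b_m = j. Line m then follows the TASEP dynamics
   driven by these bells, and it remains to show that they have, jointly with the
   initial state of line m, the law of the bells of the bottom line. Cut [0, U]
   into short slots. Off an event of small probability each slot contains at most
   one ring, so the ring counts of the slots are those of the discrete chain, and
   the finite-dimensional laws differ by as little as one wants.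

   On Z, almost surely there are arbitrarily far blocks of n + 1 consecutive
   sites whose bells are silent during [0, U]. No influence crosses such a block,
   so a process on a large cycle, driven by the same bells, agrees with the
   process on Z near the origin, except on an event of small probability. *)

Set Implicit Arguments.
Unset Strict Implicit.
Unset Printing Implicit Defensive.

Import Order.TTheory GRing.Theory Num.Theory.
Import numFieldNormedType.Exports.
Local Open Scope classical_set_scope.
Local Open Scope ring_scope.

(** * Multiline jumps *)

(** On $\mathbb{Z}$ infinitely many bells ring in every time interval, so a path cannot be unrolled
    ring by ring; nor is a process in time built on the cycle. The cycle only carries a finite chain
    on pairs (configuration, ring pattern of the slots), fed with the initial values and the ring
    counts of the given process. Off a small event, the original bells are read off such a pair $z$,
    and the bells at the sites $b_m$ off the image of $z$ under the chain. This map is a bijection,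
    and it preserves the probability of a pair: all bells have the same rate, so the weight of a
    pattern depends only on which slots contain a ring, and the chain does not change these
    slots. *)

Section PartialJump.
Variables (S : choiceType) (next prev : S -> S).
Hypothesis nextK : cancel next prev.

(** After the jump, the site before the outgoing bell carries [u b]: the minimum at [prev b] if
    [u b] is a particle, the maximum at [b] if it is a hole. So the new line and the outgoing bell
    give back [u b], hence [b]; the old value at [prev b] is the other one of the two sorted
    values. *)
Lemma tasep_jump_inj (b b' : S) (u u' : S -> bool) :
  tasep_jump prev b u =1 tasep_jump prev b' u' ->
  (if u b == particle then b else next b) =
    (if u' b' == particle then b' else next b') ->
  b = b' /\ u =1 u'.
Proof.
move=> eJ.
have out c v : tasep_jump prev c v
      (prev (if v c == particle then c else next c)) = v c.
  rewrite /tasep_jump /particle; case ev: (v c) => /=.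
    by rewrite nextK eqxx; case: (v (prev c)).
  case: eqVneq => [->|_]; first by rewrite ev.
  by rewrite eqxx; case: (v (prev c)).
move=> eo; have eub : u b = u' b' by rewrite -out -[RHS]out eJ eo.
have eb : b = b'.
  move: eo; rewrite -eub; case: ifP => // _ en.
  by rewrite -(nextK b) en nextK.
subst b'; split=> // c.
have := eJ (prev b); have := eJ b; have := eJ c.
rewrite /tasep_jump !eqxx.
case: (eqVneq c b) => [->|ncb]; first by [].
case: (eqVneq c (prev b)) => [->|//].
by rewrite eub; case: (u (prev b)); case: (u' (prev b)); case: (u' b);
  case: ifP.
Qed.

(** Sorting two values changes nothing or swaps them. A permutation of the sites preserves particle
    counts and product weights alike. *)
Lemma tasep_jump_tperm (b : S) (u : S -> bool) :
  tasep_jump prev b u =1 u \/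
  tasep_jump prev b u =1 (fun c => u (if c == b then prev b
    else if c == prev b then b else c)).
Proof.
rewrite /tasep_jump.
case eb: (u b); case ep: (u (prev b)); [left|left|right|left] => c /=.
all: case: eqVneq => [ec|_]; rewrite ?ec ?eb ?ep //.
all: by case: eqVneq => [ec|_]; rewrite ?ec ?eb ?ep.
Qed.

Variable n : nat.
Implicit Types (x : S * 'I_n -> bool) (i : S).

(* Only the lines l >= k (as ordinals) move, so that line k - 1, whose bells
   ring at the sites b_k, stays a witness of the initial state. *)
Definition partial_jump (k : nat) i x : S * 'I_n -> bool :=
  fun a => if (k <= a.2)%N then multiline_jump next prev i x a else x a.

Lemma bell_site_iter x i k : (k <= n)%N ->
  exists2 r, (r <= n - k)%N & bell_site next x i k = iter r next i.
Proof.
move=> kn; rewrite -{2}(subKn kn).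
elim: (n - k)%N (leq_subr k n) => [|m IH] mn.
  by exists 0%N => //; rewrite subn0 bell_site_bottom.
have [r rm er] := IH (ltnW mn).
have lt : (n - m.+1 < n)%N by lia.
rewrite -[X in bell_site _ _ _ X]/(nat_of_ord (Ordinal lt)) bell_siteS /=.
have -> : (n - m.+1).+1 = (n - m)%N by lia.
rewrite er; case: ifP => _; first by exists r => //; lia.
by exists r.+1; [lia|].
Qed.

(** The state is reconstructed from the top moving line downwards: from $b_l$ and the jumped line of
    ordinal $l$, [tasep_jump_inj] gives back $b_{l+1}$ and the old line. At the bottom, $b_n$ is the
    ringing site. *)
Lemma partial_jump_inj k x x' i i' : (k <= n)%N ->
  partial_jump k i x =1 partial_jump k i' x' ->
  bell_site next x i k = bell_site next x' i' k -> x =1 x' /\ i = i'.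
Proof.
move=> kn ej eb.
have key m : (k + m <= n)%N ->
    bell_site next x i (k + m) = bell_site next x' i' (k + m) /\
    forall a : S * 'I_n, (k <= a.2 < k + m)%N -> x a = x' a.
  elim: m => [|m IH] km.
    by rewrite addn0; split=> // a; lia.
  have [ebm exm] := IH ltac:(lia).
  have lt : (k + m < n)%N by lia.
  pose l := Ordinal lt.
  have := ebm.
  rewrite -[X in bell_site _ _ _ X = _]/(nat_of_ord l).
  rewrite -[X in _ = bell_site _ _ _ X]/(nat_of_ord l).
  rewrite !bell_siteS => ebm'.
  have := @tasep_jump_inj (bell_site next x i l.+1)
    (bell_site next x' i' l.+1) (fun j => x (j, l)) (fun j => x' (j, l)).
  case=> //.
    move=> j; have := ej (j, l).
    by rewrite /partial_jump /= leq_addr.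
  move=> eb1 ex1; rewrite addnS; split=> // -[s l'] /= ll'.
  have [ll|nl] := ltnP l' (k + m); first by apply: exm => /=; lia.
  have -> : l' = l by apply/val_inj => /=; lia.
  exact: ex1.
have := key (n - k)%N; rewrite subnKC // !bell_site_bottom.
case=> // ei ex; split=> // a.
have [ka|ka] := leqP k a.2; first by apply: ex; rewrite ka ltn_ord.
by have := ej a; rewrite /partial_jump leqNgt ka.
Qed.

Lemma multiline_jump_outside i x (V : S -> Prop) :
  (forall r, (r <= n)%N -> ~ V (iter r next i) /\ ~ V (prev (iter r next i))) ->
  (forall s l, V s -> multiline_jump next prev i x (s, l) = x (s, l)) /\
  (forall k, (k <= n)%N -> ~ V (bell_site next x i k)).
Proof.
move=> hV; split=> [s l Vs|k kn]; last first.
  by have [r rn ->] := bell_site_iter x i kn; apply: (hV r _).1; lia.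
rewrite /multiline_jump /= /tasep_jump.
have [r rn ->] := bell_site_iter x i (ltn_ord l).
have [h1 h2] := hV r ltac:(lia).
case: eqVneq => [es|_]; first by subst s.
by case: eqVneq => [es|//]; subst s.
Qed.

End PartialJump.

Section Window.
Variables (S : choiceType) (next prev : S -> S) (n M : nat) (e : 'I_M -> S).
Hypothesis einj : injective e.

(* e places the cycle 'I_M inside S, and W is the part of the cycle where the
   dynamics on both are compared: inner bells act in the same way on both,
   outer bells leave W alone. *)
Definition agree (W : 'I_M -> Prop) (k : nat) (x : S * 'I_n -> bool)
    (c : 'I_M * 'I_n -> bool) : Prop :=
  forall a (l : 'I_n), W a -> (k <= l)%N -> x (e a, l) = c (a, l).

Definition inner_bell W k (i : S) (a : 'I_M) : Prop :=
  e a = i /\ forall x c, agree W k x c ->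
    agree W k (multiline_jump next prev i x)
      (partial_jump (@ordS M) (@ord_pred M) k a c) /\
    bell_site next x i k = e (bell_site (@ordS M) c a k).

(** The second half is about the same bell ringing on the cycle. Near the cut, [next] and [ordS] may
    send it to different sites; all that is asked is that neither touches [W]. *)
Definition outer_bell (W : 'I_M -> Prop) k (i : S) : Prop :=
  (forall x : S * 'I_n -> bool, (forall a l, W a -> multiline_jump next prev i x (e a, l) = x (e a, l))
     /\ forall a, W a -> bell_site next x i k <> e a) /\
  (forall a, e a = i -> forall c : 'I_M * 'I_n -> bool,
     (forall a' l, W a' ->
        partial_jump (@ordS M) (@ord_pred M) k a c (a', l) = c (a', l)) /\
     ~ W (bell_site (@ordS M) c a k)).

Definition shielded W k (i : S) := (exists a, inner_bell W k i a) \/ outer_bell W k i.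

(** A bell at $a$ reads only the sites $a,\dots,a+n$ and moves only these and their predecessors. If
    they lie in [W] and [e] respects [next] and [prev] there, both dynamics read the same values and
    cross the lines at corresponding sites. *)
Lemma inner_bellP W k (a : 'I_M) : (k <= n)%N ->
  (forall r, (r <= n)%N -> let c := iter r (@ordS M) a in
    [/\ e c = iter r next (e a), prev (e c) = e (ord_pred c), W c
      & W (ord_pred c)]) ->
  inner_bell W k (e a) a.
Proof.
move=> kn hW; split=> // x c xc.
have key m : (k + m <= n)%N -> exists2 r, (r <= m)%N &
    bell_site (@ordS M) c a (n - m) = iter r (@ordS M) a /\
    bell_site next x (e a) (n - m) = iter r next (e a).
  elim: m => [|m IH] km.
    by exists 0%N => //; rewrite subn0 !bell_site_bottom.
  have [r rm [ec ex]] := IH ltac:(lia).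
  have lt : (n - m.+1 < n)%N by lia.
  rewrite -[X in bell_site _ c _ X]/(nat_of_ord (Ordinal lt)).
  rewrite -[X in bell_site _ x _ X]/(nat_of_ord (Ordinal lt)) !bell_siteS /=.
  have -> : (n - m.+1).+1 = (n - m)%N by lia.
  rewrite ec ex.
  have [er _ Wr _] := hW r ltac:(lia).
  rewrite -er xc //=; last by lia.
  case: ifP => _; first by exists r => //; lia.
  exists r.+1 => //; split=> //=.
  by rewrite er.
split; last first.
  have [r rm] := key (n - k)%N ltac:(lia).
  rewrite subKn // => -[-> ->].
  by have [<- _ _ _] := hW r ltac:(lia).
move=> a' l Wa' kl; rewrite /partial_jump /= kl /multiline_jump /=.
have [r rm] := key (n - l.+1)%N ltac:(have := ltn_ord l; lia).
rewrite subKn ?ltn_ord // => -[-> ->].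
have [er ep Wr Wp] := hW r ltac:(have := ltn_ord l; lia).
rewrite -er /tasep_jump ep !(inj_eq einj).
by rewrite !xc.
Qed.

Lemma outer_bellP (W : 'I_M -> Prop) k (i : S) : (k <= n)%N ->
  (forall r a, (r <= n)%N -> W a -> e a <> iter r next i /\
     e a <> prev (iter r next i)) ->
  (forall a, e a = i -> forall r, (r <= n)%N ->
     ~ W (iter r (@ordS M) a) /\ ~ W (ord_pred (iter r (@ordS M) a))) ->
  outer_bell W k i.
Proof.
move=> kn hS hC; split=> [x|a ea c].
  have [] := @multiline_jump_outside S next prev n i x (fun s => exists2 a, W a & e a = s).
    by move=> r rn; split=> -[a Wa]; have [] := hS r a rn Wa.
  move=> h1 h2; split=> [a l Wa|a Wa eb]; first by apply: h1; exists a.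
  by apply: (h2 k kn); exists a.
have [h1 h2] := multiline_jump_outside c (hC a ea).
split=> [a' l Wa'|]; last exact: h2.
by rewrite /partial_jump /=; case: ifP => // _; exact: h1.
Qed.

End Window.

(** * The discrete chain on a cycle *)

Section CycleChain.
Variables (M n k : nat).
Hypothesis kn : (k <= n)%N.

Definition config := {ffun 'I_M * 'I_n -> bool}.
Implicit Types (c : config) (v : option 'I_M).

Definition cycle_jump (a : 'I_M) c : config :=
  [ffun z => partial_jump (@ordS M) (@ord_pred M) k a c z].

(** [None] is a slot without a ring; the second component is the ring as it arrives at $b_k$. *)
Definition chain_step c v : config * option 'I_M :=
  if v is Some a then (cycle_jump a c, Some (bell_site (@ordS M) c a k))
  else (c, None).

Fixpoint chain_run c (vs : seq (option 'I_M)) : config * seq (option 'I_M) :=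
  if vs is v :: vs' then
    let cv := chain_step c v in let r := chain_run cv.1 vs' in
    (r.1, cv.2 :: r.2)
  else (c, [::]).

Lemma chain_step_inj c c' v v' :
  chain_step c v = chain_step c' v' -> c = c' /\ v = v'.
Proof.
case: v v' => [a|] [a'|] //=; last by case.
case=> ec eb.
have [z||ex ->] := @partial_jump_inj _ (@ordS M) (@ord_pred M)
  (@ordSK M) n k c c' a a' kn.
- by have /ffunP/(_ z) := ec; rewrite !ffunE.
- by [].
- by split=> //; apply/ffunP.
Qed.

(** Time is undone backwards: the tail of the run gives back the configuration after the first step,
    and [chain_step_inj] inverts this step. *)
Lemma chain_run_inj c c' vs vs' :
  chain_run c vs = chain_run c' vs' -> c = c' /\ vs = vs'.
Proof.
elim: vs vs' c c' => [|v vs IH] [|v' vs'] c c' //=; first by case.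
case=> e1 e2 e3.
have [|ec ->] := IH vs' (chain_step c v).1 (chain_step c' v').1.
  by rewrite [LHS]surjective_pairing [RHS]surjective_pairing e1 e3.
have [|-> ->//] := @chain_step_inj c c' v v'.
by rewrite [LHS]surjective_pairing [RHS]surjective_pairing ec e2.
Qed.

Lemma chain_run_isSome c vs : map isSome (chain_run c vs).2 = map isSome vs.
Proof. by elim: vs c => //= v vs IH c; rewrite IH; case: v. Qed.

Lemma size_chain_run c vs : size (chain_run c vs).2 = size vs.
Proof. by elim: vs c => //= v vs IH c; rewrite IH. Qed.

(** For k = m + 1 this covers the ordinal m, so a run keeps the initial state of the line under
    study. *)
Lemma chain_run_above c vs a (l : 'I_n) : (l < k)%N ->
  (chain_run c vs).1 (a, l) = c (a, l).
Proof.
move=> lk; elim: vs c => //= v vs IH c; rewrite IH.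
by case: v => //= b; rewrite ffunE /partial_jump /= leqNgt lk.
Qed.

Lemma chain_run_invariant (R : Type) (f : config -> R) c vs :
  (forall a c', f (cycle_jump a c') = f c') -> f (chain_run c vs).1 = f c.
Proof.
by move=> hf; elim: vs c => //= v vs IH c; rewrite IH; case: v => //=.
Qed.

End CycleChain.

Lemma near_all_seq (I : eqType) (U : Type) (F : set_system U) (FF : Filter F)
    (l : seq I) (A : I -> U -> Prop) :
  (forall i, i \in l -> \forall u \near F, A i u) ->
  \forall u \near F, forall i, i \in l -> A i u.
Proof.
elim: l => [|a l IH] h; first by apply: nearW.
have h1 := h a (mem_head _ _).
have h2 := IH (fun i il => h i (mem_behead (s := a :: l) il)).
near=> u => i; rewrite inE => /orP[/eqP ->|]; first by near: u.
by move: i; near: u.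
Unshelve. all: by end_near. Qed.

(** * Times of rings *)

Section RealInduction.
Variable R : realType.
Implicit Types (s t u r : R).

(** The supremum of the times up to which [A] holds must be t. This replaces induction over
    successive jumps, which cannot be listed in increasing order when infinitely many bells ring. *)
Lemma real_induction (A : R -> Prop) s t : s <= t -> A s ->
  (forall r, s <= r < t -> (forall u, s <= u <= r -> A u) ->
     \forall u \near r^'+, A u) ->
  (forall r, s < r <= t -> (forall u, s <= u < r -> A u) -> A r) ->
  forall u, s <= u <= t -> A u.
Proof.
move=> st As Ar Al.
pose E := [set u | s <= u <= t /\ forall v, s <= v <= u -> A v].
have Es : E s by split=> [|v sv]; [lra|have -> : v = s by lra].
have Eub : ubound E t by move=> u [/andP[]].
have Eb : has_ubound E by exists t.
have sr : s <= sup E by apply: (ub_le_sup Eb).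
have rt : sup E <= t by apply: ge_sup => //; exists s.
have below u : s <= u < sup E -> A u.
  move=> /andP[su ur].
  have [v [_ Ev] uv] := sup_adherent (ltac:(lra) : 0 < sup E - u)
    (conj (ex_intro _ s Es) Eb).
  by apply: Ev; lra.
have upto u : s <= u <= sup E -> A u.
  move=> /andP[su]; rewrite le_eqVlt => /orP[/eqP ->|ur]; last first.
    by apply: below; rewrite su.
  move: sr; rewrite le_eqVlt => /orP[/eqP <- //|sr].
  by apply: Al => //; rewrite sr.
suff -> : t = sup E by [].
apply/eqP; rewrite eq_le rt andbT leNgt; apply/negP => rt'.
have /(_ _ upto) := Ar (sup E).
rewrite sr rt' => /(_ isT) [d /= d0 hd].
pose v := Num.min (sup E + d / 2) t.
have rv : sup E < v by rewrite /v lt_min; apply/andP; split; lra.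
have vt : v <= t by rewrite /v ge_min lexx orbT.
have vd : v <= sup E + d / 2 by rewrite /v ge_min lexx.
have : E v.
  split=> [|u /andP[su uv]]; first by lra.
  have [ur|ru] := leP u (sup E); first by apply: upto; rewrite su.
  by apply: hd => //=; rewrite ltr_norml; lra.
by move=> /(ub_le_sup Eb); lra.
Qed.

Lemma near_left_ex (A : R -> Prop) s t : s < t ->
  (\forall u \near t^'-, A u) -> exists2 u, s < u < t & A u.
Proof.
move=> st At.
have [u [[Au su] ut]] : exists u, (A u /\ s < u) /\ u < t.
  apply: (@filter_ex _ t^'-).
  by apply: filterI; [apply: filterI => //; exact: nbhs_left_gt|exact: nbhs_left_lt].
by exists u => //; rewrite su.
Qed.

Lemma near_right_gt (A : R -> Prop) s t : s < t ->
  (forall u, s < u < t -> A u) -> \forall u \near s^'+, A u.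
Proof.
move=> st h; near=> u; apply: h; apply/andP; split; near: u.
  exact: nbhs_right_gt.
exact: nbhs_right_lt.
Unshelve. all: by end_near. Qed.

End RealInduction.

Section CountingPaths.
Variable R : realType.
Implicit Types (s t u r : R) (N : R -> nat) (Z : set R).

(** Right continuity carries the value past a time r; at r itself, the absence of a ring gives an
    earlier time with a count at least as large. *)
Lemma ring_increment N s t : counting_path N -> 0 <= s <= t ->
  (forall r, s < r <= t -> ~ rings_at N r) -> N t = N s.
Proof.
case=> N0 Nm Nr /andP[s0 st] hno.
apply: (@real_induction _ (fun u => N u = N s) s t) => //.
- move=> r /andP[sr rt] h; rewrite -(h r) ?sr ?lexx //.
  by apply: Nr; lra.
- move=> r /andP[sr rt] h.
  have /not_andP[|] := hno r ltac:(lra); first by case; lra.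
  move=> /existsNP[u /not_implyP[u0 /not_implyP[ur]]] /negP; rewrite -leqNgt.
  move=> Nru; apply/eqP; rewrite eqn_leq (Nm s r s0 (ltW sr)) andbT.
  apply: (leq_trans Nru); rewrite -(h (Num.max u s)).
    by rewrite Nm // le_max lexx.
  by rewrite le_max lexx orbT gt_max ur.
- by rewrite st lexx.
Qed.

Lemma rings_lt N s r t : counting_path N -> 0 <= s -> s < r <= t ->
  rings_at N r -> (N s < N t)%N.
Proof.
case=> _ Nm _ s0 /andP[sr rt] [r0 h].
by apply: leq_trans (h s s0 sr) _; rewrite Nm // ltW.
Qed.

Lemma single_ring N s t : counting_path N -> 0 <= s <= t ->
  (N t - N s)%N = 1%N ->
  exists r, [/\ s < r <= t, rings_at N r
    & forall r', s < r' <= t -> rings_at N r' -> r' = r].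
Proof.
move=> hN /andP[s0 st] N1.
have [r [hr Nr]] : exists r, s < r <= t /\ rings_at N r.
  apply: contrapT => hno.
  move: N1; rewrite (@ring_increment N s t) ?subnn ?s0 //.
  by move=> r hr Nr; apply: hno; exists r.
exists r; split=> // r' hr' Nr'.
have key a b : s < a -> a < b -> b <= t -> rings_at N a -> ~ rings_at N b.
  move=> sa ab bt Na Nb.
  have h1 := rings_lt hN s0 (ltac:(lra) : s < a <= a) Na.
  have h2 := rings_lt hN (ltac:(lra) : 0 <= a) (ltac:(lra) : a < b <= t) Nb.
  by move: N1 h1 h2; lia.
have [h|h|//] := ltgtP r' r.
- by case: (key r' r) => //; lra.
- by case: (key r r') => //; lra.
Qed.

(** A counting path takes different values at different ring times, and at most [N t] at those up to
    t. *)
Lemma finite_rings N t : counting_path N ->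
  finite_set [set r | rings_at N r /\ r <= t].
Proof.
move=> hN.
have inj : set_inj [set r | rings_at N r /\ r <= t] N.
  move=> r r' /set_mem [Nr rt] /set_mem [Nr' rt'] e.
  have [h|h|//] := ltgtP r r'.
  - by have := Nr'.2 r (ltW Nr.1) h; rewrite e ltnn.
  - by have := Nr.2 r' (ltW Nr'.1) h; rewrite e ltnn.
rewrite -(eq_finite_set (inj_card_eq inj)).
apply: (@sub_finite_set _ _ `I_(N t).+1); last exact: finite_II.
move=> _ [r [Nr rt] <-] /=; rewrite ltnS.
by case: hN => _ Nm _; rewrite Nm // ltW //; case: Nr.
Qed.

Definition num_points Z s t := #|` fset_set (Z `&` [set r | s < r <= t])|.

Definition locally_finite_times Z :=
  forall t, finite_set (Z `&` [set r | 0 < r <= t]).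

Section LocallyFinite.
Variable Z : set R.
Hypothesis lfZ : locally_finite_times Z.

Lemma finite_points s t : 0 <= s -> finite_set (Z `&` [set r | s < r <= t]).
Proof.
by move=> s0; apply: sub_finite_set (lfZ t) => r [Zr /= ?]; split=> //=; lra.
Qed.

Lemma num_points_split s u t : 0 <= s -> s <= u <= t ->
  num_points Z s t = (num_points Z s u + num_points Z u t)%N.
Proof.
move=> s0 /andP[su ut]; rewrite /num_points.
have -> : Z `&` [set r | s < r <= t] =
    (Z `&` [set r | s < r <= u]) `|` (Z `&` [set r | u < r <= t]).
  rewrite -setIUr; congr (_ `&` _); apply/seteqP; split=> r /=.
    by move=> ?; have [|] := leP r u => ?; [left|right]; lra.
  by move=> []; lra.
rewrite fset_setU; [|apply: finite_points; lra|apply: finite_points; lra].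
rewrite cardfsU -fset_setI; [|apply: finite_points; lra|apply: finite_points; lra].
rewrite [X in (_ - #|` fset_set X |)%N](_ : _ = set0) ?fset_set0 ?cardfs0 ?subn0 //.
by apply/seteqP; split=> r //= [[_ ?] [_ ?]]; lra.
Qed.

Lemma num_points0 s t : (forall r, s < r <= t -> ~ Z r) -> num_points Z s t = 0%N.
Proof.
move=> h; rewrite /num_points (_ : _ `&` _ = set0) ?fset_set0 ?cardfs0 //.
by apply/seteqP; split=> // r [Zr /= /h].
Qed.

Lemma num_points1 s t r : s < r <= t -> Z r ->
  (forall r', s < r' <= t -> Z r' -> r' = r) -> num_points Z s t = 1%N.
Proof.
move=> hr Zr h; rewrite /num_points (_ : _ `&` _ = [set r]).
  by rewrite fset_set1 cardfs1.
by apply/seteqP; split=> r' /=; [move=> [Zr' /h]; exact|move=> ->].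
Qed.

Lemma num_points_gt0 s t r : 0 <= s -> s < r <= t -> Z r ->
  (0 < num_points Z s t)%N.
Proof.
move=> s0 hr Zr; rewrite cardfs_gt0; apply/eqP => e.
suff : r \in fset_set (Z `&` [set r | s < r <= t]) by rewrite e.
by rewrite in_fset_set ?inE //; exact: finite_points.
Qed.

Lemma near_right_points t : 0 <= t ->
  \forall s \near t^'+, num_points Z t s = 0%N.
Proof.
move=> t0.
have : \forall s \near t^'+, forall r, r \in (fset_set (Z `&` [set r | t < r <= t + 1]) : seq R) -> s < r.
  apply: near_all_seq => r; rewrite in_fset_set ?inE; last exact: finite_points.
  by move=> [_ /= /andP[tr _]]; exact: nbhs_right_lt.
move=> hn; near=> s; apply: num_points0 => r hr Zr.
have : s < r.
  have hs : forall r, r \in (fset_set (Z `&` [set r | t < r <= t + 1]) : seq R) -> s < r.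
    by near: s.
  apply: hs; rewrite in_fset_set ?inE; last exact: finite_points.
  split=> //=; suff : s < t + 1 by lra.
  by near: s; apply: nbhs_right_lt; lra.
by lra.
Unshelve. all: by end_near. Qed.

Lemma counting_num_points : counting_path (num_points Z 0).
Proof.
split.
- by apply: num_points0 => r; lra.
- by move=> s t s0 st; rewrite (@num_points_split 0 s t) ?leq_addr// s0.
- move=> t t0; have h := near_right_points t0.
  near=> s; rewrite (@num_points_split 0 t s) //.
    by rewrite (_ : num_points Z t s = 0%N) ?addn0 //; near: s.
  by rewrite t0; near: s; exact: nbhs_right_ge.
Unshelve. all: by end_near. Qed.

Lemma rings_num_points t : rings_at (num_points Z 0) t <-> 0 < t /\ Z t.
Proof.
split=> [[t0 h]|[t0 Zt]]; last first.
  split=> // s s0 st; rewrite (@num_points_split 0 s t) ?s0 ?(ltW st)//.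
  by rewrite -[X in (X < _)%N]addn0 ltn_add2l (@num_points_gt0 s t t) // st lexx.
split=> //; apply: contrapT => nZ.
have : \forall s \near t^'-, num_points Z s t = 0%N /\ 0 <= s.
  have : \forall s \near t^'-, forall r, r \in (fset_set (Z `&` [set r | 0 < r <= t]) : seq R) -> r < s.
    apply: near_all_seq => r; rewrite in_fset_set ?inE; last exact: finite_points.
    move=> [Zr /= /andP[_ rt]]; apply: nbhs_left_gt.
    by move: rt; rewrite le_eqVlt => /orP[/eqP e|//]; case: nZ; rewrite -e.
  move=> hn; near=> s; split; last by near: s; apply: nbhs_left_ge.
  apply: num_points0 => r hr Zr.
  have s0 : 0 <= s by near: s; apply: nbhs_left_ge.
  have hs : forall r, r \in (fset_set (Z `&` [set r | 0 < r <= t]) : seq R) -> r < s.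
    by near: s.
  suff : r < s by lra.
  by apply: hs; rewrite in_fset_set ?inE; [split=> //=; lra|exact: finite_points].
move=> /(near_left_ex t0) [s /andP[s0 st] [e _]].
have := h s (ltW s0) st; rewrite (@num_points_split 0 s t) ?(ltW s0) ?(ltW st)//.
by rewrite e addn0 ltnn.
Unshelve. all: by end_near. Qed.

End LocallyFinite.

End CountingPaths.

Section FollowedPath.
Variables (R : realType) (S L : Type) (jump : S -> (L -> bool) -> (L -> bool))
  (N : S -> R -> nat) (p : R -> L -> bool).
Hypothesis hp : follows_bells jump N p.
Implicit Types (s t u r : R) (l : L) (xm : L -> bool).

Definition left_limit t xm := forall l, \forall s \near t^'-, p s l = xm l.

Lemma left_limit_unique t xm xm' : left_limit t xm -> left_limit t xm' -> xm = xm'.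
Proof.
move=> h h'; apply/funext => l.
have [s [-> ->//]] : exists s, p s l = xm l /\ p s l = xm' l.
by apply: (@filter_ex _ t^'-); apply: filterI; [exact: h|exact: h'].
Qed.

Lemma left_limit_const s t xm l : s < t -> left_limit t xm ->
  (forall u, s < u < t -> p u l = p s l) -> xm l = p s l.
Proof.
by move=> st /(_ l) /(near_left_ex st) [u hu <-] h; exact: h.
Qed.

(** One coordinate is followed at a time, as the whole state may jump infinitely often in ]s, t]. *)
Lemma coordinate_constant s t l : 0 <= s <= t ->
  (forall r i, s < r <= t -> rings_at (N i) r -> forall x, jump i x l = x l) ->
  forall u, s <= u <= t -> p u l = p s l.
Proof.
move=> /andP[s0 st] hno; have [hr hl] := hp.
apply: (real_induction st) => // r /andP[h1 h2] h.
  by rewrite -(h r) ?h1 ?lexx //; apply: hr; lra.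
have [xm [xmP xmJ xmN]] := hl r ltac:(lra).
have exm : xm l = p s l.
  by apply: (left_limit_const h1 xmP) => u hu; apply: h; lra.
rewrite -exm.
have [[i Ni]|nring] := pselect (exists i, rings_at (N i) r).
  by rewrite (xmJ i Ni) (hno r i) //; lra.
by rewrite xmN // => i Ni; apply: nring; exists i.
Qed.

End FollowedPath.

(** * The bells that a line hears *)

Section Output.
Variables (R : realType) (S : choiceType) (next prev : S -> S) (n : nat).
Hypothesis nextK : cancel next prev.
Variables (N : S -> R -> nat) (p : R -> S * 'I_n -> bool).
Hypothesis hN : forall i, counting_path (N i).
Hypothesis hp : follows_bells (@multiline_jump S next prev n) N p.
Variable k : nat.
Hypothesis kn : (k <= n)%N.

(** A bell acts on the state just before it rings, hence the left limit: at t the path has already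
    jumped. *)
Definition output_times (j : S) : set R :=
  [set t | exists i xm, [/\ rings_at (N i) t, left_limit p t xm
                          & bell_site next xm i k = j]].

Definition output_bells (j : S) (t : R) : nat :=
  num_points (output_times j) 0 t.

Lemma output_times_gt0 j t : output_times j t -> 0 < t.
Proof. by move=> [i [xm [[]]]]. Qed.

Lemma iter_nextK r : cancel (iter r next) (iter r prev).
Proof. by move=> i; elim: r => //= r IH; rewrite -iterS iterSr nextK. Qed.

(** A ring that arrives at j comes from one of $j-n,\dots,j$, and each of these bells rings finitely
    often up to t. *)
Lemma output_times_finite j : locally_finite_times (output_times j).
Proof.
move=> t.
apply: (@sub_finite_set _ _ (\bigcup_(r in `I_n.+1)
    [set u | rings_at (N (iter r prev j)) u /\ u <= t])).
  move=> u [[i [xm [Ni _ eb]]] /= hu].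
  have [r rn er] := bell_site_iter next xm i kn.
  exists r => /=; first by lia.
  by split; [rewrite -eb er iter_nextK|lra].
apply: bigcup_finite => [|r _]; first exact: finite_II.
exact: finite_rings.
Qed.

Lemma output_counting j : counting_path (output_bells j).
Proof. exact/counting_num_points/output_times_finite. Qed.

Lemma output_ringsP j t : rings_at (output_bells j) t <-> output_times j t.
Proof.
rewrite /output_bells rings_num_points; last exact: output_times_finite.
by split=> [[]//|h]; split=> //; exact: output_times_gt0 h.
Qed.

Lemma output_bellsB j s t : 0 <= s <= t ->
  (output_bells j t - output_bells j s)%N = num_points (output_times j) s t.
Proof.
move=> /andP[s0 st].
rewrite /output_bells (num_points_split (output_times_finite j) (lexx 0) (_ : 0 <= s <= t)).
  by rewrite addKn.
by rewrite s0.
Qed.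

(** The ordinal m stands for line m + 1, whose bell rings at $b_{m+1}$. *)
Lemma line_follows_output (m : 'I_n) : k = m.+1 ->
  follows_bells (tasep_jump prev) output_bells (fun t s => p t (s, m)).
Proof.
move=> km; have [hr hl] := hp; split=> [t s t0|t t0]; first exact: hr.
have [xm [xmP xmJ xmN]] := hl t t0.
exists (fun s => xm (s, m)); split=> [s|j /output_ringsP|hno]; first exact: xmP.
  move=> [i [xm' [Ni /(left_limit_unique xmP) <- <-]]].
  by rewrite (xmJ i Ni); apply/funext => s; rewrite /multiline_jump /= km.
rewrite xmN // => i Ni; apply: (hno (bell_site next xm i k)).
by apply/output_ringsP; exists i, xm.
Qed.

Section Slots.
Variables (M : nat) (e : 'I_M -> S).
Hypothesis einj : injective e.
Variables (W : 'I_M -> Prop) (T : R).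
Hypothesis hW : forall i, (0 < N i T)%N -> shielded next prev n e W k i.

Lemma rings_shielded i t : rings_at (N i) t -> t <= T -> shielded next prev n e W k i.
Proof.
move=> Ni tT; apply: hW; have := rings_lt (hN i) (lexx 0) _ Ni.
by move=> /(_ T); rewrite tT Ni.1; case: (hN i) => -> _ _; exact.
Qed.

(** Infinitely many bells of [S] may ring in the slot. The inner ones are counted by [v], so at most
    one of them rings; all others are outer and leave [W] alone. Hence the window jumps at most
    once, from its value at s. *)
Lemma slot_step s t (c : config M n) (v : option 'I_M) :
  0 <= s <= t -> t <= T ->
  (forall a, (N (e a) t - N (e a) s)%N = (v == Some a)) ->
  agree e W k (p s) c ->
  agree e W k (p t) (chain_step k c v).1 /\
  forall a, W a -> (output_bells (e a) t - output_bells (e a) s)%N =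
                   ((chain_step k c v).2 == Some a).
Proof.
move=> /andP[s0 st] tT hv hc.
have inner_v r i a : s < r <= t -> rings_at (N i) r -> inner_bell next prev n e W k i a ->
    v = Some a.
  move=> hr Ni [ea _]; apply/eqP; move: (hv a); rewrite ea.
  by have := rings_lt (hN i) s0 hr Ni; case: eqP => // _; lia.
have outer_const r1 r2 : s <= r1 -> r1 <= r2 -> r2 <= t ->
    (forall r i, r1 < r <= r2 -> rings_at (N i) r -> outer_bell next prev n e W k i) ->
    forall a l, W a -> p r2 (e a, l) = p r1 (e a, l).
  move=> h1 h2 h3 ho a l Wa.
  apply: (@coordinate_constant R S _ _ N p hp r1 r2 (e a, l)).
  - by lra.
  - by move=> r i hr Ni x; have [/(_ x) [-> //]] := ho r i hr Ni.
  - by lra.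
have shield r i : s < r <= t -> rings_at (N i) r ->
    shielded next prev n e W k i by move=> hr /rings_shielded; apply; lra.
have outB a : (output_bells (e a) t - output_bells (e a) s)%N =
    num_points (output_times (e a)) s t by rewrite output_bellsB ?s0.
case: v hv inner_v => [a0|] hv inner_v; last first.
  have ho r i : s < r <= t -> rings_at (N i) r -> outer_bell next prev n e W k i.
    move=> hr Ni; have [[a ha]|//] := shield r i hr Ni.
    by have := inner_v r i a hr Ni ha.
  split=> [a l Wa kl|a Wa] /=.
    by rewrite (outer_const s t) //; exact: hc.
  rewrite outB num_points0 // => r hr [i [xm [Ni _ eb]]].
  by have [/(_ xm) [_ /(_ a Wa)]] := ho r i hr Ni.
have [r0 [hr0 Nr0 uniq]] : exists r, [/\ s < r <= t, rings_at (N (e a0)) r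
    & forall r', s < r' <= t -> rings_at (N (e a0)) r' -> r' = r].
  by apply: single_ring => //; [rewrite s0|rewrite hv eqxx].
have ho r i : s < r <= t -> r != r0 -> rings_at (N i) r -> outer_bell next prev n e W k i.
  move=> hr rr0 Ni; have [[a ha]|//] := shield r i hr Ni.
  have [ea] := inner_v r i a hr Ni ha.
  by case/eqP: rr0; apply: uniq => //; case: ha => + _; rewrite -ea => ->.
have [xm [xmP xmJ _]] := hp.2 r0 ltac:(lra).
have exm a l : W a -> xm (e a, l) = p s (e a, l).
  move=> Wa; apply: (left_limit_const (_ : s < r0) xmP); first by lra.
  move=> u hu; apply: (outer_const s u) => //; try lra.
  by move=> r i hr; apply: ho; [lra|apply/eqP; lra].
have ept a l : W a -> p t (e a, l) = multiline_jump next prev (e a0) xm (e a, l).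
  move=> Wa; rewrite -(xmJ _ Nr0).
  apply: (outer_const r0 t) => //; try lra.
  by move=> r i hr; apply: ho; [lra|apply/eqP; lra].
(* At sites of [W] the output can only come from the ring at [r0]: the rings of other bells are
   outer and arrive outside [W]. *)
have outE a : W a -> num_points (output_times (e a)) s t =
    (`[< bell_site next xm (e a0) k = e a >] : nat).
  move=> Wa.
  have hZ r : s < r <= t -> output_times (e a) r ->
      r = r0 /\ bell_site next xm (e a0) k = e a.
    move=> hr [i [xm' [Ni xmP' eb]]].
    have [[a' ha']|] := shield r i hr Ni; last first.
      by move=> [/(_ xm') [_ /(_ a Wa)]].
    have [ea'] := inner_v r i a' hr Ni ha'.
    have ei : i = e a0 by rewrite ea'; case: ha'.
    have er : r = r0 by apply: uniq => //; rewrite -ei.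
    split=> //; rewrite er in xmP'.
    by rewrite (left_limit_unique xmP xmP') -ei.
  case: asboolP => h.
    rewrite (@num_points1 _ _ s t r0) //; first by exists (e a0), xm.
    by move=> r' hr' /(hZ r' hr')[].
  by rewrite num_points0 // => r hr /(hZ r hr)[].
have hcm : agree e W k xm c by move=> a l Wa kl; rewrite exm //; exact: hc.
have [[a [ea ha]]|[ho1 ho2]] := shield r0 (e a0) hr0 Nr0.
  have ? : a = a0 by exact: einj.
  subst a; have [hJ hb] := ha xm c hcm.
  split=> [a l Wa kl|a Wa] /=.
    by rewrite ffunE ept //; exact: hJ.
  rewrite outB outE // hb /=; congr nat_of_bool.
  by apply/asboolP/eqP => [/einj ->|[->]].
(* The ring counted by [v] may itself be outer. Then path and chain both leave [W] alone, though
   they may send the ring to different sites outside it. *)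
have [h1 h2] := ho1 xm; have [h3 h4] := ho2 a0 erefl c.
split=> [a l Wa kl|a Wa] /=.
  by rewrite ffunE ept // h1 // h3 //; exact: hcm.
rewrite outB outE //; congr nat_of_bool.
apply/asboolP/eqP => [eb|[ea]]; first by have := h2 a Wa.
by rewrite -ea in Wa.
Qed.

Lemma grid_run (g : nat -> R) (vs : seq (option 'I_M)) q0 (c : config M n) :
  0 <= g q0 -> (forall q, g q <= g q.+1) -> g (q0 + size vs)%N <= T ->
  (forall q a, (q < size vs)%N ->
    (N (e a) (g (q0 + q).+1) - N (e a) (g (q0 + q)))%N = (nth None vs q == Some a)) ->
  agree e W k (p (g q0)) c ->
  forall q a, (q < size vs)%N -> W a ->
    (output_bells (e a) (g (q0 + q).+1) - output_bells (e a) (g (q0 + q)))%N =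
    (nth None (chain_run k c vs).2 q == Some a).
Proof.
move=> g0 gm; elim: vs q0 c g0 => [//|v vs IH] q0 c g0 gT hv hc q a qs Wa.
have gmono i j : (i <= j)%N -> g i <= g j.
  by move: i j; exact/nondecreasing_seqP.
have [] := @slot_step (g q0) (g q0.+1) c v.
- by rewrite g0 gm.
- by apply: le_trans gT; apply: gmono => /=; lia.
- by move=> a'; have := hv 0%N a' isT; rewrite addn0.
- by [].
move=> hc' hout.
case: q qs => [|q] qs /=; first by rewrite addn0 hout.
rewrite addnS -addSn.
apply: (IH q0.+1) => //.
- exact: le_trans (gm _).
- by rewrite addSnnS.
- by move=> q' a' hq'; have := hv q'.+1 a' hq'; rewrite addnS addSn.
Qed.

End Slots.

End Output.

Lemma bell_site_eq (S : choiceType) (next : S -> S) n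
    (x x' : S * 'I_n -> bool) i k : (k <= n)%N ->
  (forall r l, (r <= n)%N -> x (iter r next i, l) = x' (iter r next i, l)) ->
  bell_site next x i k = bell_site next x' i k.
Proof.
move=> kn h; rewrite -(subKn kn).
elim: (n - k)%N (leq_subr k n) => [|m IH] mn.
  by rewrite subn0 !bell_site_bottom.
have lt : (n - m.+1 < n)%N by lia.
rewrite -[X in bell_site _ x _ X]/(nat_of_ord (Ordinal lt)).
rewrite -[X in bell_site _ x' _ X]/(nat_of_ord (Ordinal lt)) !bell_siteS /=.
have -> : (n - m.+1).+1 = (n - m)%N by lia.
rewrite -(IH (ltnW mn)).
have [r rm ->] := bell_site_iter next x i (leq_subr m n).
by rewrite h //; lia.
Qed.

Section Approximation.
Variables (R : realType) (S : choiceType) (next prev : S -> S) (n : nat).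
Hypothesis nextK : cancel next prev.
Variable k : nat.
Hypothesis kn : (k <= n)%N.

(* The number of rings at j is the limit of counts of slots of a uniform grid,
   which only involve the state and the bells at finitely many times. *)
Definition uniform_grid (t : R) q r : R := t * r%:R / q.+1%:R.

(** Only the bells at $j-n,\dots,j$ can arrive at j. The state at the left end of the slot stands
    for the left limit at the ring. *)
Definition slot_flag (N : S -> R -> nat) (p : R -> S * 'I_n -> bool) j s t : bool :=
  has (fun r => (N (iter r prev j) t != N (iter r prev j) s) &&
     (bell_site next (p s) (iter r prev j) k == j)) (iota 0 n.+1).

Definition flag_count N p j t q : nat :=
  \sum_(r < q.+1) slot_flag N p j (uniform_grid t q r) (uniform_grid t q r.+1).

Variables (N : S -> R -> nat) (p : R -> S * 'I_n -> bool).
Hypothesis hN : forall i, counting_path (N i).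
Hypothesis hp : follows_bells (@multiline_jump S next prev n) N p.

Lemma sum_num_points Z (g : nat -> R) m : locally_finite_times Z -> g 0%N = 0 ->
  (forall r, g r <= g r.+1) ->
  (\sum_(r < m) num_points Z (g r) (g r.+1))%N = num_points Z 0 (g m).
Proof.
move=> lfZ g0 gm; have g_ge r : 0 <= g r.
  by rewrite -g0; move/nondecreasing_seqP: gm; exact.
elim: m => [|m IH]; first by rewrite big_ord0 g0 num_points0 // => r; lra.
rewrite big_ord_recr /= IH -num_points_split //.
by rewrite g_ge gm.
Qed.

(** This will make the output measurable. Finitely many rings up to t can reach j. Slots shorter
    than a common [d] contain at most one of them, and at the left end of its slot the sites that it
    reads already have their left limits. *)
Lemma flag_count_eventually j t : 0 <= t ->
  exists q0, forall q, (q0 <= q)%N ->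
    flag_count N p j t q = output_bells next N p k j t.
Proof.
move=> t0.
pose Fs := \bigcup_(r in `I_n.+1) [set u | rings_at (N (iter r prev j)) u /\ u <= t].
have Ffin : finite_set Fs.
  apply: bigcup_finite => [|r _]; first exact: finite_II.
  exact: finite_rings.
have /finite_seqP[F FE] := Ffin.
have memF x : x \in F <-> Fs x by rewrite FE.
pose good x u := (forall y, y \in F -> y < x -> y <= u) /\
  (forall xm r, left_limit p x xm -> (r <= n)%N ->
     bell_site next (p u) (iter r prev j) k = bell_site next xm (iter r prev j) k).
have [d d0 hd] : exists2 d, 0 < d & forall x, x \in F -> forall u, x - d < u < x -> good x u.
  have : \forall d \near (0 : R)^'+, forall x, x \in F -> forall u, x - d < u < x -> good x u.
    apply: near_all_seq => x xF.
    have x0 : 0 < x by have /memF [r _ [[]]] := xF.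
    have : \forall u \near x^'-, good x u.
      have [xm [xmP _ _]] := hp.2 x x0.
      have h1 : \forall u \near x^'-, forall y, y \in F -> y < x -> y <= u.
        apply: near_all_seq => y yF; have [yx|xy] := ltP y x.
          by near=> u => _; near: u; exact: nbhs_left_ge.
        by apply: nearW.
      have h2 : \forall u \near x^'-, forall rr, rr \in enum {: 'I_n.+1 * 'I_n.+1 * 'I_n} ->
          p u (iter rr.1.1 next (iter rr.1.2 prev j), rr.2) =
          xm (iter rr.1.1 next (iter rr.1.2 prev j), rr.2).
        by apply: near_all_seq => rr _; exact: xmP.
      near=> u; split; first by near: u.
      move=> xm' r /(left_limit_unique xmP) <- rn.
      apply: bell_site_eq => // r' l r'n.
      have h3 : forall rr, rr \in enum {: 'I_n.+1 * 'I_n.+1 * 'I_n} ->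
          p u (iter rr.1.1 next (iter rr.1.2 prev j), rr.2) =
          xm (iter rr.1.1 next (iter rr.1.2 prev j), rr.2) by near: u.
      by have := h3 (Ordinal (r'n : (r' < n.+1)%N), Ordinal (rn : (r < n.+1)%N), l);
        rewrite mem_enum => /(_ isT).
    move=> [b /= b0 hb].
    apply: (near_right_gt b0) => d /andP[d0 db] u hu.
    by apply: hb => /=; [rewrite gtr0_norm; lra|lra].
  move=> h; have [d [hd d0]] : exists d, (forall x, x \in F -> forall u, x - d < u < x -> good x u) /\ 0 < d.
    by apply: (@filter_ex _ (0 : R)^'+); apply: filterI => //; exact: nbhs_right_gt.
  by exists d.
(* For q at least this, the mesh $t/(q+1)$ is smaller than [d]. *)
pose q0 := Num.truncn (t / d).
exists q0 => q q0q.
pose g := uniform_grid t q.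
have q1 : 0 < (q.+1%:R : R) by rewrite ltr0n.
have mesh r : g r.+1 - g r < d.
  rewrite /g /uniform_grid -mulrBl -mulrBr -natrB // subSnn mulr1.
  rewrite ltr_pdivrMr //.
  have := Num.Theory.truncnS_gt (t / d); rewrite ltr_pdivrMr // mulrC => h.
  apply: lt_le_trans h _; rewrite ler_pM2l // ler_nat; exact: q0q.
have gm r : g r <= g r.+1.
  by rewrite /g /uniform_grid ler_pM2r ?invr_gt0 // ler_wpM2l // ler_nat.
have g0 : g 0%N = 0 by rewrite /g /uniform_grid mulr0 mul0r.
have gt : g q.+1 = t by rewrite /g /uniform_grid mulfK // gt_eqF.
have g_ge r : 0 <= g r by rewrite -g0; move/nondecreasing_seqP: gm; exact.
have g_le r : (r <= q.+1)%N -> g r <= t.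
  by rewrite -[X in _ -> _ <= X]gt; move/nondecreasing_seqP: gm => gm'; exact: gm'.
have lf := output_times_finite nextK p hN kn j.
rewrite /flag_count /output_bells -[in RHS]gt -sum_num_points //.
apply: eq_bigr => r _; rewrite -/g.
have ring_ex x : output_times next N p k j x -> x <= t -> exists2 r', (r' <= n)%N &
    exists xm, [/\ rings_at (N (iter r' prev j)) x, left_limit p x xm
                 & bell_site next xm (iter r' prev j) k = j].
  move=> [i [xm [Ni xmP eb]]] xt.
  have [r' r'n er] := bell_site_iter next xm i kn.
  exists r'; first by lia.
  have -> : iter r' prev j = i by rewrite -eb er iter_nextK.
  by exists xm.
have rt : g r.+1 <= t by apply: g_le.
case ef : slot_flag => /=.
  have /hasP[r' + /andP[Nne /eqP eb]] := ef.
  rewrite mem_iota add0n ltnS => /andP[_ r'n].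
  have [x [hx Nx]] : exists x, g r < x <= g r.+1 /\ rings_at (N (iter r' prev j)) x.
    apply: contrapT => hno; case/eqP: Nne; apply: ring_increment => //.
      by rewrite g_ge gm.
    by move=> x hx Nx; apply: hno; exists x.
  have xF : x \in F by apply/memF; exists r' => //; split=> //; lra.
  have [xm [xmP _ _]] := hp.2 x Nx.1.
  have slotd y : g r < y <= g r.+1 -> y - d < g r < y by have := mesh r; lra.
  have [_ /(_ xm r' xmP r'n) eb'] := hd x xF (g r) (slotd x hx).
  rewrite (@num_points1 _ _ _ _ x) //.
    by exists (iter r' prev j), xm; split=> //; rewrite -eb'.
  move=> y hy /ring_ex []; first by lra.
  move=> r'' r''n [xm' [Ny _ _]].
  have yF : y \in F by apply/memF; exists r'' => //; split=> //; lra.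
  have [yx|xy|//] := ltgtP y x.
    by have [/(_ y yF yx) ] := hd x xF (g r) (slotd x hx); lra.
  by have [/(_ x xF xy) ] := hd y yF (g r) (slotd y hy); lra.
rewrite num_points0 // => x hx /ring_ex []; first by lra.
move=> r' r'n [xm [Nx xmP eb]].
have xF : x \in F by apply/memF; exists r' => //; split=> //; lra.
move/negP: ef; apply; apply/hasP; exists r'; first by rewrite mem_iota add0n ltnS.
have slotd : x - d < g r < x by have := mesh r; lra.
have [_ /(_ xm r' xmP r'n) ->] := hd x xF (g r) slotd.
rewrite eb eqxx andbT gtn_eqF //.
exact: rings_lt (hN _) (g_ge r) hx Nx.
Unshelve. all: by end_near. Qed.

End Approximation.

(** * Events and laws *)

Section FiberMeasurable.
Context {d : measure_display} {T : measurableType d}.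

(** For a countable codomain this is measurability, without a choice of sigma-algebra on it. *)
Definition fiber_measurable (I : Type) (f : T -> I) :=
  forall i, measurable [set w | f w = i].

Lemma fiber_measurable_cst (I : Type) (i : I) : fiber_measurable (fun _ => i).
Proof.
move=> j; have [->|ne] := pselect (i = j).
  by rewrite (_ : [set w | _] = setT) //; apply/seteqP; split.
by rewrite (_ : [set w | _] = set0) //; apply/seteqP; split.
Qed.

Lemma fiber_measurable_set (I : countType) (f : T -> I) (A : I -> Prop) :
  fiber_measurable f -> measurable [set w | A (f w)].
Proof.
move=> mf; rewrite (_ : [set w | _] = \bigcup_(i in A) [set w | f w = i]).
  rewrite bigcup_mkcond; apply: countable_bigcupT_measurable => [|i].
    exact: countableP.
  by case: ifP => // _; exact: mf.
by apply/seteqP; split=> [w Aw|w [i Ai /= e]]; [exists (f w)|rewrite /= e].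
Qed.

Lemma fiber_measurable_comp (I : countType) (J : Type) (f : T -> I) (h : I -> J) :
  fiber_measurable f -> fiber_measurable (fun w => h (f w)).
Proof. by move=> mf j; exact: (fiber_measurable_set (fun i => h i = j) mf). Qed.

Lemma fiber_measurable_pair (I J : Type) (f : T -> I) (g : T -> J) :
  fiber_measurable f -> fiber_measurable g ->
  fiber_measurable (fun w => (f w, g w)).
Proof.
move=> mf mg [i j]; rewrite (_ : [set w | _] = [set w | f w = i] `&` [set w | g w = j]).
  exact: measurableI.
by apply/seteqP; split=> w /= [-> ->].
Qed.

Lemma fiber_measurable_comp2 (I J : countType) (K : Type) (f : T -> I) (g : T -> J)
    (h : I -> J -> K) :
  fiber_measurable f -> fiber_measurable g ->
  fiber_measurable (fun w => h (f w) (g w)).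
Proof.
move=> mf mg; have := fiber_measurable_pair mf mg.
by move=> /(@fiber_measurable_comp _ _ _ (fun ij => h ij.1 ij.2)).
Qed.

Lemma fiber_measurable_fun {d'} (I : measurableType d') (f : T -> I) :
  (forall i : I, measurable [set i]) ->
  measurable_fun setT f -> fiber_measurable f.
Proof.
move=> m1 mf i; rewrite (_ : [set w | _] = setT `&` f @^-1` [set i]) ?setTI //.
by rewrite -[X in measurable X]setTI; exact: mf.
Qed.

Lemma measurable_fun_fiber {d'} (I : measurableType d') (f : T -> I) :
  countable [set: I] -> fiber_measurable f -> measurable_fun setT f.
Proof.
move=> cI mf _ A mA; rewrite setTI.
rewrite (_ : f @^-1` A = \bigcup_(i in A) [set w | f w = i]).
  rewrite bigcup_mkcond; apply: countable_bigcupT_measurable => // i.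
  by case: ifP => // _; exact: mf.
by apply/seteqP; split=> [w Aw|w [i Ai /= e]]; [exists (f w)|rewrite /= e].
Qed.

Lemma measurable_forall (I : countType) (A : I -> T -> Prop) :
  (forall i, measurable [set w | A i w]) -> measurable [set w | forall i, A i w].
Proof.
move=> mA; rewrite (_ : [set w | _] = ~` \bigcup_i ~` [set w | A i w]).
  apply: measurableC; apply: countable_bigcupT_measurable; first exact: countableP.
  by move=> i; exact: measurableC.
rewrite setC_bigcup; apply/seteqP; split=> w /= h i; last by have := h i Logic.I; rewrite setCK.
by move=> _; rewrite setCK; exact: h.
Qed.

Lemma measurable_exists (I : countType) (A : I -> T -> Prop) :
  (forall i, measurable [set w | A i w]) -> measurable [set w | exists i, A i w].
Proof.
move=> mA; rewrite (_ : [set w | _] = \bigcup_i [set w | A i w]).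
  by apply: countable_bigcupT_measurable; first exact: countableP.
by apply/seteqP; split=> w /= [i]; exists i.
Qed.

Lemma bigcap_seq_measurable (I : eqType) (l : seq I) (F : I -> set T) :
  (forall i, measurable (F i)) -> measurable (\bigcap_(i in [set` l]) F i).
Proof.
by move=> mF; apply: fin_bigcap_measurable.
Qed.

Lemma fiber_measurable_seq (I : eqType) (J : Type) (f : I -> T -> J) (l : seq I) :
  (forall i, i \in l -> fiber_measurable (f i)) ->
  fiber_measurable (fun w => [seq f i w | i <- l]).
Proof.
elim: l => [|a l IH] mf s.
  have [->|ns] := pselect (s = [::]).
    by rewrite (_ : [set w | _] = setT) //; apply/seteqP.
  by rewrite (_ : [set w | _] = set0) //; apply/seteqP; split=> // w /= /esym.
case: s => [|j s].
  by rewrite (_ : [set w | _] = set0) //; apply/seteqP; split=> // w.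
rewrite (_ : [set w | _] = [set w | f a w = j] `&` [set w | [seq f i w | i <- l] = s]).
  apply: measurableI; first by apply: mf; rewrite mem_head.
  by apply: IH => i il; apply: mf; rewrite inE il orbT.
by apply/seteqP; split=> w /=; [move=> [-> ->]|move=> [-> ->]].
Qed.

End FiberMeasurable.

Section FiniteApproximation.
Context {R : realType} {d : measure_display} {T : measurableType d}.
Variable P : probability T R.
Variables (I : finType) (H : I -> set T).
Hypotheses (mH : forall i, measurable (H i)) (tH : trivIset setT H).

Lemma measure_finite_union (Q : pred I) :
  P (\bigcup_(i in [set` Q]) H i) = (\sum_(i | Q i) P (H i))%E.
Proof.
rewrite measure_fin_bigcup.
- by rewrite -(@bigfs _ _ _ _ (index_enum I)) ?index_enum_uniq // => i _; rewrite mem_index_enum.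
- exact: finite_finset.
- exact: sub_trivIset tH.
- by move=> i _; exact: mH.
Qed.

Lemma finite_approx (A B : set T) (Q : pred I) :
  measurable A -> measurable B ->
  (forall w, ~ B w -> exists i, H i w) ->
  (forall w i, ~ B w -> H i w -> A w <-> Q i) ->
  (P A <= P B + \sum_(i | Q i) P (H i))%E /\
  (\sum_(i | Q i) P (H i) <= P A + P B)%E.
Proof.
move=> mA mB hex hQ; rewrite -measure_finite_union.
have mU : measurable (\bigcup_(i in [set` Q]) H i).
  by apply: fin_bigcup_measurable => //; exact: finite_finset.
split.
  apply: (@le_trans _ _ (P (B `|` \bigcup_(i in [set` Q]) H i))).
    apply: le_measure; rewrite ?inE //; first exact: measurableU.
    move=> w Aw; have [|nB] := pselect (B w); first by left.
    by right; have [i Hi] := hex w nB; exists i => //=; apply/(hQ w i).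
  exact: measureU2.
apply: (@le_trans _ _ (P (A `|` B))); last exact: measureU2.
apply: le_measure; rewrite ?inE //; first exact: measurableU.
move=> w [i /= Qi Hi]; have [|nB] := pselect (B w); first by right.
by left; apply/(hQ w i).
Qed.

(** Off [B], the event [A] is the union of the cells in [Q], and [A'] that of the cells which [tau]
    sends into [Q]. As [tau] permutes finitely many cells and preserves their weights, both unions
    have the same probability; each of the two comparisons costs [P B]. *)
Lemma finite_transfer (tau : I -> I) (A A' B : set T) (Q : pred I) :
  injective tau -> (forall i, P (H (tau i)) = P (H i)) ->
  measurable A -> measurable A' -> measurable B ->
  (forall w, ~ B w -> exists i, H i w) ->
  (forall w i, ~ B w -> H i w -> A w <-> Q i) ->
  (forall w i, ~ B w -> H i w -> A' w <-> Q (tau i)) ->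
  (P A <= P A' + (P B + P B))%E /\ (P A' <= P A + (P B + P B))%E.
Proof.
move=> tauI tauP mA mA' mB hex hQ hQ'.
have [a1 a2] := finite_approx mA mB hex hQ.
have [b1 b2] := finite_approx mA' mB hex hQ'.
have e : (\sum_(i | Q i) P (H i) = \sum_(i | Q (tau i)) P (H i))%E.
  by rewrite (reindex_inj tauI); apply: eq_bigr => i _; exact: tauP.
rewrite {}e in a1 a2; split.
  by apply: (le_trans a1); rewrite addeCA leeD2l.
by apply: (le_trans b1); rewrite addeCA leeD2l.
Qed.

End FiniteApproximation.

(** * From finite-dimensional laws to generated sigma-algebras *)

Section PiLambda.
Context {R : realType} {d : measure_display} {T : measurableType d}.
Variable P : probability T R.
Variables (I : Type) (D : set I) (f f' : I -> T -> nat).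
Hypotheses (mf : forall i, D i -> fiber_measurable (f i))
  (mf' : forall i, D i -> fiber_measurable (f' i)).
Hypothesis ff' : forall l : seq (I * nat), (forall z, List.In z l -> D z.1) ->
  P [set w | forall z, List.In z l -> f z.1 w = z.2] =
  P [set w | forall z, List.In z l -> f' z.1 w = z.2].

Definition cylinder (A : set (I -> nat)) : Prop :=
  exists l : seq (I * nat), (forall z, List.In z l -> D z.1) /\
    A = [set p | forall z, List.In z l -> p z.1 = z.2].

(** Two events cut out by the same set of paths, one for [f] and one for [f']. The relation is
    closed under complements, countable unions and finite intersections, and so it transports
    independence from one family to the other. *)
Definition same_event (E E' : set T) : Prop :=
  exists A, <<s cylinder >> A /\
    (E = [set w | A (f ^~ w)] /\ E' = [set w | A (f' ^~ w)]).

Lemma measurable_cylinder_preimage (g : I -> T -> nat) A :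
  (forall i, D i -> fiber_measurable (g i)) ->
  <<s cylinder >> A -> measurable [set w | A (g ^~ w)].
Proof.
move=> mg; move: A; apply: smallest_sub.
  split=> /= [|A mA|F mF].
  - by rewrite (_ : [set w | _] = set0) //.
  - rewrite (_ : [set w | _] = ~` [set w | A (g ^~ w)]).
      exact: measurableC.
    by apply/seteqP; split=> w /= => [[]|].
  - rewrite (_ : [set w | _] = \bigcup_k [set w | F k (g ^~ w)]) //.
    exact: bigcupT_measurable.
move=> _ [l [Dl ->]] /=; elim: l Dl => [|z l IH] Dl.
  by rewrite (_ : [set w | _] = setT) //; apply/seteqP; split=> // w _ z [].
rewrite (_ : [set w | _] = [set w | g z.1 w = z.2] `&`
    [set w | forall z, List.In z l -> g z.1 w = z.2]).
  apply: measurableI; first by apply: mg; apply: Dl; left.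
  by apply: IH => y yl; apply: Dl; right.
apply/seteqP; split=> w /=.
  by move=> h; split=> [|y yl]; apply: h; [left|right].
by move=> [h1 h2] y [<-//|]; exact: h2.
Qed.

Lemma cylinder_setI : setI_closed cylinder.
Proof.
move=> _ _ [l [Dl ->]] [l' [Dl' ->]]; exists (l ++ l'); split.
  by move=> z /List.in_app_iff[]; [exact: Dl|exact: Dl'].
apply/seteqP; split=> p /=.
  by move=> [h h'] z /List.in_app_iff[]; [exact: h|exact: h'].
by move=> h; split=> z zl; apply: h; apply/List.in_app_iff; [left|right].
Qed.

(** Dynkin induction: cylinders are closed under intersection, and on them the equality is [ff']. *)
Lemma same_event_measure E E' : same_event E E' -> P E = P E'.
Proof.
move=> [A [sA [-> ->]]]; move: A sA.
apply: (@dynkin_induction _ (g_sigma_algebraType cylinder) cylinder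
  (fun A => P [set w | A (f ^~ w)] = P [set w | A (f' ^~ w)])).
- by [].
- exact: cylinder_setI.
- by [].
- by move=> _ [l [Dl ->]]; exact: ff'.
- move=> A sA e.
  rewrite [in LHS](_ : [set w | _] = ~` [set w | A (f ^~ w)]) //.
  rewrite [in RHS](_ : [set w | _] = ~` [set w | A (f' ^~ w)]) //.
  rewrite !probability_setC ?e //; first exact: (measurable_cylinder_preimage mf' sA).
  exact: (measurable_cylinder_preimage mf sA).
- move=> F mF tF e.
  rewrite [in LHS](_ : [set w | _] = \bigcup_k [set w | F k (f ^~ w)]) //.
  rewrite [in RHS](_ : [set w | _] = \bigcup_k [set w | F k (f' ^~ w)]) //.
  rewrite !measure_bigcup //.
  + by apply: eq_eseriesr => k _; exact: e.
  + by move=> k _; exact: (measurable_cylinder_preimage mf' (mF k)).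
  + apply/trivIsetP => i j _ _ ij; apply/seteqP; split=> // w /= [h1 h2].
    have /trivIsetP/(_ i j Logic.I Logic.I ij)/seteqP[+ _] := tF.
    by move=> /(_ (f' ^~ w)) /=; apply.
  + by move=> k _; exact: (measurable_cylinder_preimage mf (mF k)).
  + apply/trivIsetP => i j _ _ ij; apply/seteqP; split=> // w /= [h1 h2].
    have /trivIsetP/(_ i j Logic.I Logic.I ij)/seteqP[+ _] := tF.
    by move=> /(_ (f ^~ w)) /=; apply.
Qed.

(** There are countably many sequences of values, so the event is a countable union of cylinders,
    whatever [Q] is. *)
Lemma same_event_fun (l : seq I) (Q : seq nat -> Prop) :
  (forall i, List.In i l -> D i) ->
  same_event [set w | Q [seq f i w | i <- l]] [set w | Q [seq f' i w | i <- l]].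
Proof.
move=> Dl; exists [set p | Q [seq p i | i <- l]]; split=> //.
rewrite (_ : [set p | _] = \bigcup_(s in [set s | Q s /\ size s = size l])
    [set p | forall z, List.In z (zip l s) -> p z.1 = z.2]).
  rewrite bigcup_mkcond.
  apply: (@countable_bigcupT_measurable _ (g_sigma_algebraType cylinder)).
    exact: countableP.
  move=> s; case: ifP => [/set_mem /= [_ es]|_]; last exact: measurable0.
  apply: sub_sigma_algebra; exists (zip l s); split=> //.
  move=> z; elim: l s Dl es => [|i l IH] [|k s] //= Dl [es] [<-/=|].
    by apply: Dl; left.
  by apply: IH => // j jl; apply: Dl; right.
apply/seteqP; split=> p /=.
  move=> Qp; exists [seq p i | i <- l]; first by rewrite /= size_map.
  by elim: (l) => //= i l' IH z [<-//|]; exact: IH.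
move=> [s /= [Qs es] h]; rewrite (_ : [seq p i | i <- l] = s) //.
elim: l s {Qs Dl} es h => [|i l IH] [|k s] //= [es] h.
rewrite (h (i, k)); last by left.
by congr cons; apply: IH => // z zl; apply: h; right.
Qed.

Lemma same_eventC E E' : same_event E E' -> same_event (~` E) (~` E').
Proof.
move=> [A [sA [-> ->]]]; exists (~` A); split=> //.
exact: (@measurableC _ (g_sigma_algebraType cylinder)).
Qed.

Lemma same_event_bigcup (E E' : nat -> set T) :
  (forall k, same_event (E k) (E' k)) ->
  same_event (\bigcup_k E k) (\bigcup_k E' k).
Proof.
move=> /choice[A hA]; exists (\bigcup_k A k); split; last split.
- by apply: (@bigcupT_measurable _ (g_sigma_algebraType cylinder)) => k; case: (hA k).
- by apply: eq_bigcupr => k _; case: (hA k) => _ [->].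
- by apply: eq_bigcupr => k _; case: (hA k) => _ [_ ->].
Qed.

Lemma same_event_setI E E' F F' : same_event E E' -> same_event F F' ->
  same_event (E `&` F) (E' `&` F').
Proof.
move=> [A [sA [-> ->]]] [B [sB [-> ->]]]; exists (A `&` B); split=> //.
exact: (@measurableI _ (g_sigma_algebraType cylinder)).
Qed.

Lemma same_event_bigcap (J : eqType) (s : seq J) (E E' : J -> set T) :
  (forall j, j \in s -> same_event (E j) (E' j)) ->
  same_event (\bigcap_(j in [set` s]) E j) (\bigcap_(j in [set` s]) E' j).
Proof.
elim: s => [|j s IH] h.
  exists setT; split; first exact: (@measurableT _ (g_sigma_algebraType cylinder)).
  by split; apply/seteqP; split=> // w _ j.
have -> : [set` j :: s] = j |` [set` s].
  apply/seteqP; split=> i /=; rewrite inE; first by case/orP => [/eqP|]; [left|right].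
  by case=> [->|->]; rewrite ?eqxx ?orbT.
rewrite !bigcap_setU1.
apply: same_event_setI; first by apply: h; rewrite mem_head.
by apply: IH => i is_; apply: h; rewrite inE is_ orbT.
Qed.

End PiLambda.

(** * Ring counts of independent Poisson bells *)

Section PoissonBells.
Context {R : realType} {d : measure_display} {T : measurableType d}.
Variable P : probability T R.

Lemma measure_exists_le (I : finType) (A : I -> set T) (b : R) :
  (forall i, measurable (A i)) -> (forall i, (P (A i) <= b%:E)%E) ->
  (P [set w | exists i, A i w] <= (#|I|%:R * b)%:E)%E.
Proof.
move=> mA hA.
have key (l : seq I) : (P [set w | exists2 i, i \in l & A i w] <= ((size l)%:R * b)%:E)%E.
  elim: l => [|i l IH].
    by rewrite (_ : [set w | _] = set0) ?measure0 ?mul0r //; apply/seteqP; split=> // w [].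
  rewrite (_ : [set w | _] = A i `|` [set w | exists2 i, i \in l & A i w]); last first.
    apply/seteqP; split=> w /=.
      by move=> [j]; rewrite inE => /orP[/eqP ->|jl Aj]; [left|right; exists j].
    move=> [Ai|[j jl Aj]]; first by exists i => //; rewrite mem_head.
    by exists j => //; rewrite inE jl orbT.
  have mU : measurable [set w | exists2 i, i \in l & A i w].
    rewrite (_ : [set w | _] = [set w | exists i, i \in l /\ A i w]).
      apply: measurable_exists => j; case: (boolP (j \in l)) => jl.
        by rewrite (_ : [set w | _] = A j) //; apply/seteqP; split=> w /= => [[]|].
      by rewrite (_ : [set w | _] = set0) //; apply/seteqP; split=> w /= => [[]|].
    by apply/seteqP; split=> w /= [j]; [exists j|case; exists j].
  apply: (le_trans (measureU2 _ _ _)) => //=.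
  rewrite -natr1 mulrDl mul1r addrC EFinD; exact: leeD.
have := key (enum I); rewrite -cardE; congr (P _ <= _)%E.
by apply/seteqP; split=> w /= [i]; [exists i|exists i; rewrite // mem_enum].
Qed.

Section OneProcess.
Variable N : R -> T -> nat.
Hypothesis hN : rate1_poisson_process P N.
Implicit Types s t : R.

(** The case r = 0 is a point mass at 0: slots of length 0 occur when an observation time is
    repeated. *)
Definition increment_pmf (r : R) (k : nat) : R :=
  if 0 < r then poisson_pmf r k else (k == 0%N)%:R.

Lemma bells_fiber t : 0 <= t -> fiber_measurable (N t).
Proof. by move=> t0; apply: fiber_measurable_fun => //; case: hN => h _ _ _; exact: h. Qed.

Lemma increment_fiber s t : 0 <= s -> 0 <= t ->
  fiber_measurable (fun w => N t w - N s w)%N.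
Proof.
by move=> s0 t0; apply: (fiber_measurable_comp2 subn); exact: bells_fiber.
Qed.

Lemma increment_law s t k : 0 <= s <= t ->
  P [set w | (N t w - N s w)%N = k] = (increment_pmf (t - s) k)%:E.
Proof.
move=> /andP[s0]; rewrite /increment_pmf subr_gt0 le_eqVlt => /orP[/eqP <-|st].
  rewrite ltxx; case: eqP => [->|k0].
    rewrite (_ : [set w | _] = setT) ?probability_setT //.
    by apply/seteqP; split=> // w _ /=; rewrite subnn.
  rewrite (_ : [set w | _] = set0) ?measure0 //.
  by apply/seteqP; split=> // w /=; rewrite subnn => /esym.
by rewrite st; case: hN => _ _ h _; exact: h.
Qed.

Lemma increment_gt0 s t : 0 <= s <= t ->
  (P [set w | 0 < N t w - N s w]%N <= (t - s)%:E)%E.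
Proof.
move=> st; have m0 := increment_fiber (s := s) (t := t) ltac:(lra) ltac:(lra) 0%N.
rewrite (_ : [set w | _] = ~` [set w | (N t w - N s w)%N = 0%N]); last first.
  by apply/seteqP; split=> w /=; rewrite lt0n => /eqP.
rewrite probability_setC // increment_law // -EFinB lee_fin /increment_pmf.
case: ifP => [ts|_]; last by rewrite eqxx /=; lra.
rewrite /poisson_pmf ts expr0 mul1r fact0 invr1 mul1r.
by have := expR_ge1Dx (- (t - s)); lra.
Qed.

(** With $x=t-s>0$ the probability is $1-e^{-x}(1+x)$, and $e^{-x}\ge1-x$ bounds it by
    $1-(1-x)(1+x)=x^2$. *)
Lemma increment_gt1 s t : 0 <= s <= t ->
  (P [set w | 1 < N t w - N s w]%N <= ((t - s) ^+ 2)%:E)%E.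
Proof.
move=> st; have mk k := increment_fiber (s := s) (t := t) ltac:(lra) ltac:(lra) k.
rewrite (_ : [set w | _] = ~` ([set w | (N t w - N s w)%N = 0%N] `|`
    [set w | (N t w - N s w)%N = 1%N])); last first.
  apply/seteqP; split=> w /=; first by move=> h []; lia.
  by move=> h; rewrite ltnNge; apply/negP => h'; apply: h; lia.
rewrite probability_setC; last exact: measurableU.
have -> : P ([set w | (N t w - N s w)%N = 0%N] `|` [set w | (N t w - N s w)%N = 1%N]) =
    (P [set w | (N t w - N s w)%N = 0%N] + P [set w | (N t w - N s w)%N = 1%N])%E.
  by apply: measureU => //; apply/seteqP; split=> // w /= []; lia.
rewrite !increment_law // -EFinD lee_fin /increment_pmf.
case: ifP => [ts|_]; last first.
  by rewrite eqxx /=; have := sqr_ge0 (t - s); lra.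
rewrite /poisson_pmf ts expr0 mul1r fact0 invr1 mul1r expr1 mulr1.
have := expR_ge1Dx (- (t - s)); move: ts; set x := t - s => x0 h.
by have : 0 <= (expR (- x) - (1 - x)) * (1 + x); [rewrite mulr_ge0; lra|nra].
Qed.

End OneProcess.

Section Family.
Variables (S : choiceType) (L : Type) (N : S -> R -> T -> nat) (X0 : T -> L -> bool).
Hypothesis hN : forall i, rate1_poisson_process P (N i).
Hypothesis hI : mutually_independent P (fun o : option S =>
        match o with
        | Some i => g_sigma_family [set t : R | 0 <= t] (N i)
        | None => g_sigma_family [set: L] (fun l w => X0 w l)
        end).

Lemma family_fiber (I K : Type) {d' : measure_display} (V : measurableType d')
    (D : set I) (f : I -> T -> V) i :
  (forall v : V, measurable [set v]) -> D i ->
  @fiber_measurable _ (g_sigma_algebraType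
    (\bigcup_(k in D) g_sigma_algebra_preimage (f k))) _ (f i).
Proof.
move=> m1 Di v; apply: sub_sigma_algebra; exists i => //.
by exists [set v] => //; rewrite setTI.
Qed.

Lemma independent_bells (s : seq S) (E : S -> set T) (C : set T) :
  uniq s -> (forall i, i \in s -> g_sigma_family [set t : R | 0 <= t] (N i) (E i)) ->
  g_sigma_family [set: L] (fun l w => X0 w l) C ->
  P (C `&` \bigcap_(i in [set` s]) E i) = (P C * \prod_(i <- s) P (E i))%E.
Proof.
move=> us hE hC.
have := hI (s := None :: map Some s) (E := fun o => if o is Some i then E i else C).
rewrite /= map_inj_uniq ?us ?andbT; last by move=> x y [].
rewrite big_cons big_map => <-.
- congr (P _); apply/seteqP; split=> w /=.
    move=> [Cw hw] [i|] //=; rewrite inE /= => h; apply: hw.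
    by case/mapP: h => j js [->].
  move=> hw; split; first by apply: (hw None); rewrite /= mem_head.
  by move=> i /= is_; apply: (hw (Some i)); rewrite /= inE /= map_f.
- by apply/negP => /mapP[].
- by move=> [i|] //=; rewrite inE /= => /mapP[j js [->]]; exact: hE.
Qed.

Lemma independent_bells0 (s : seq S) (E : S -> set T) :
  uniq s -> (forall i, i \in s -> g_sigma_family [set t : R | 0 <= t] (N i) (E i)) ->
  P (\bigcap_(i in [set` s]) E i) = (\prod_(i <- s) P (E i))%E.
Proof.
move=> us hE; have := independent_bells us hE (@measurableT _ (g_sigma_algebraType
    (\bigcup_(l in [set: L]) g_sigma_algebra_preimage (fun w => X0 w l)))).
by rewrite setTI probability_setT mul1e.
Qed.

Section Grid.
Variables (M : nat) (e : 'I_M -> S).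
Hypothesis einj : injective e.
Variables (g : nat -> R) (K : nat).
Hypotheses (g0 : 0 <= g 0%N) (gm : forall q, g q <= g q.+1).

Definition increment i q w := (N i (g q.+1) w - N i (g q) w)%N.

Lemma grid_ge0 q : 0 <= g q.
Proof. by apply: (le_trans g0); move/nondecreasing_seqP: gm; exact. Qed.

Lemma increment_family i q k :
  g_sigma_family [set t : R | 0 <= t] (N i) [set w | increment i q w = k].
Proof.
have fm t : 0 <= t -> _ := fun h => @family_fiber R unit _ nat [set t : R | 0 <= t] (N i) t (fun _ => I) h.
exact: (fiber_measurable_comp2 subn (fm _ (grid_ge0 q.+1)) (fm _ (grid_ge0 q)) k).
Qed.

Lemma joint_increments (C : set T) (kappa : 'I_M -> nat -> nat) :
  g_sigma_family [set: L] (fun l w => X0 w l) C ->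
  P (C `&` [set w | forall a (q : 'I_K), increment (e a) q w = kappa a q]) =
  (P C * \prod_(a : 'I_M) \prod_(q < K)
     (increment_pmf (g q.+1 - g q) (kappa a q))%:E)%E.
Proof.
move=> hC.
(* Independence is indexed by the sites of [S], so the event at i is expressed through the a with
   [e a = i]. *)
pose E i := [set w | forall a, e a = i -> forall q : 'I_K, increment i q w = kappa a q].
have -> : [set w | forall a (q : 'I_K), increment (e a) q w = kappa a q] =
    \bigcap_(i in [set` map e (enum 'I_M)]) E i.
  apply/seteqP; split=> w /= h.
    by move=> _ /mapP[a _ ->] a' /einj -> q; exact: h.
  by move=> a q; apply: (h (e a)) => //; rewrite /= map_f // mem_enum.
rewrite independent_bells //; first last.
- move=> _ /mapP[a _ ->].
  apply: (@measurable_forall _ (g_sigma_algebraType _)) => a'.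
  have [/einj ->|ne] := pselect (e a' = e a).
    rewrite [X in measurable X](_ : _ = [set w | forall q : 'I_K, increment (e a) q w = kappa a q]).
      by apply: (@measurable_forall _ (g_sigma_algebraType _)) => q; exact: increment_family.
    by apply/seteqP; split=> w /=; [apply|move=> h _].
  rewrite [X in measurable X](_ : _ = setT); first exact: measurableT.
  by apply/seteqP; split=> // w _ /ne.
- by rewrite map_inj_uniq // enum_uniq.
congr (_ * _)%E; rewrite big_map big_enum /=; apply: eq_bigr => a _.
have -> : E (e a) = \bigcap_(q in [set` iota 0 K]) [set w | increment (e a) q w = kappa a q].
  apply/seteqP; split=> w /= h.
    by move=> q /=; rewrite mem_iota add0n => /= qK; exact: (h a erefl (Ordinal qK)).
  by move=> a' /einj -> q; apply: h; rewrite /= mem_iota add0n ltn_ord.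
case: (hN (e a)) => _ _ _ /(_ g g0 gm) ->.
- rewrite -[X in iota X _]/0%N -(big_mkord xpredT (fun q => (increment_pmf (g q.+1 - g q) (kappa a q))%:E)).
  rewrite /index_iota subn0; apply: eq_bigr => q _.
  by rewrite increment_law // grid_ge0 gm.
- exact: iota_uniq.
- by move=> q _; exists [set kappa a q] => //; rewrite setTI.
Qed.

(* Two rings in the same slot: at one site for a diagonal pair z.2, and at two
   sites otherwise. *)
Definition crowded w := exists z : 'I_K * ('I_M * 'I_M),
  if z.2.1 == z.2.2 then (1 < increment (e z.2.1) z.1 w)%N
  else (0 < increment (e z.2.1) z.1 w)%N && (0 < increment (e z.2.2) z.1 w)%N.

Lemma increment_fm i q : fiber_measurable (increment i q).
Proof. by apply: increment_fiber => //; exact: grid_ge0. Qed.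

Lemma crowded_case_measurable (z : 'I_K * ('I_M * 'I_M)) :
  measurable [set w | if z.2.1 == z.2.2 then (1 < increment (e z.2.1) z.1 w)%N
    else (0 < increment (e z.2.1) z.1 w)%N && (0 < increment (e z.2.2) z.1 w)%N].
Proof.
case: eqP => _.
  exact: (fiber_measurable_set (fun k => (1 < k)%N) (increment_fm _ _)).
exact: (fiber_measurable_set (fun kl : nat * nat => (0 < kl.1)%N && (0 < kl.2)%N)
  (fiber_measurable_pair (increment_fm _ _) (increment_fm _ _))).
Qed.

Lemma measurable_crowded : measurable [set w | crowded w].
Proof. by apply: measurable_exists => z; exact: crowded_case_measurable. Qed.

(** Union bound over K slots and $M^2$ pairs of sites. A given pair costs $b^2$, by [increment_gt1]
    on the diagonal and by independence off it; this square beats the number of slots when the grid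
    is refined. *)
Lemma measure_crowded (b : R) : (forall q, g q.+1 - g q <= b) ->
  (P [set w | crowded w] <= (K%:R * M%:R ^+ 2 * b ^+ 2)%:E)%E.
Proof.
move=> hb.
have b2 q : (g q.+1 - g q) ^+ 2 <= b ^+ 2.
  by rewrite ler_sqr ?nnegrE ?subr_ge0 //; apply: le_trans (hb 0%N); rewrite subr_ge0.
have := @measure_exists_le _ _ (b ^+ 2) crowded_case_measurable.
rewrite !card_prod !card_ord !natrM -expr2; apply.
move=> [q [a a']] /=; apply: (@le_trans _ _ ((g q.+1 - g q) ^+ 2)%:E); last by rewrite lee_fin.
case: eqP => [_|/eqP aa'].
  by apply: increment_gt1 => //; rewrite grid_ge0 gm.
have hpos i : (P [set w | 0 < increment i q w]%N <= (g q.+1 - g q)%:E)%E.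
  by apply: increment_gt0 => //; rewrite grid_ge0 gm.
rewrite (_ : [set w | _] = \bigcap_(i in [set` [:: e a; e a']]) [set w | (0 < increment i q w)%N]).
  rewrite independent_bells0.
  - rewrite big_cons big_seq1 expr2 EFinM; exact: lee_pmul.
  - by rewrite /= inE andbT (inj_eq einj).
  - move=> i _.
    have fm : @fiber_measurable _ (g_sigma_algebraType (\bigcup_(t in [set t : R | 0 <= t])
      g_sigma_algebra_preimage (N i t))) _ (increment i q) := @increment_family i q.
    exact: (fiber_measurable_set (fun k => (0 < k)%N) fm).
apply/seteqP; split=> w /=.
  by move=> /andP[h1 h2] i /=; rewrite !inE => /orP[] /eqP ->.
by move=> h; apply/andP; split; apply: h; rewrite /= !inE eqxx ?orbT.
Qed.

Lemma not_crowded w : ~ crowded w -> forall q, (q < K)%N ->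
  exists v : option 'I_M, forall a, increment (e a) q w = (v == Some a).
Proof.
move=> nc q qK.
have [[a ha]|h0] := pselect (exists a, (0 < increment (e a) q w)%N); last first.
  exists None => a; apply/eqP; rewrite -leqn0 leqNgt; apply/negP => h.
  by apply: h0; exists a.
exists (Some a) => a'.
rewrite (inj_eq Some_inj); have [<-|ne] := eqVneq a a'.
  apply/eqP; rewrite eqn_leq ha andbT leqNgt; apply/negP => h.
  by apply: nc; exists (Ordinal qK, (a, a)); rewrite /= eqxx.
apply/eqP; rewrite -leqn0 leqNgt; apply/negP => h.
by apply: nc; exists (Ordinal qK, (a, a')); rewrite /= (negPf ne) ha h.
Qed.

(** All bells have the same rate, so a transposition of the sites takes one pattern to the other
    without changing the weight. This plays the part of the uniform choice of the ringing site. *)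
Lemma slot_weight (r : R) (v v' : option 'I_M) : isSome v = isSome v' ->
  (\prod_(a : 'I_M) (increment_pmf r (v == Some a))%:E =
   \prod_(a : 'I_M) (increment_pmf r (v' == Some a))%:E)%E.
Proof.
case: v v' => [b|] [b'|] //= _.
rewrite (reindex_inj (@perm_inj _ (tperm b b'))); apply: eq_bigr => a _.
congr (increment_pmf _ (nat_of_bool _))%:E.
rewrite !(inj_eq Some_inj) -{1}(tpermR b b').
by rewrite (inj_eq (@perm_inj _ _)).
Qed.

Definition slot_cell (C : set T) (vs : seq (option 'I_M)) : set T :=
  C `&` [set w | forall a (q : 'I_K), increment (e a) q w = (nth None vs q == Some a)].

Lemma measure_slot_cell (C C' : set T) vs vs' :
  g_sigma_family [set: L] (fun l w => X0 w l) C ->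
  g_sigma_family [set: L] (fun l w => X0 w l) C' ->
  P C = P C' -> size vs = K -> map isSome vs = map isSome vs' ->
  P (slot_cell C vs) = P (slot_cell C' vs').
Proof.
move=> hC hC' eC sv ev.
have sv' : size vs' = K by rewrite -sv -(size_map isSome) -ev size_map.
rewrite /slot_cell.
rewrite (joint_increments (fun a q => nth None vs q == Some a : nat) hC).
rewrite (joint_increments (fun a q => nth None vs' q == Some a : nat) hC').
rewrite eC; congr (_ * _)%E; rewrite exchange_big [RHS]exchange_big /=.
apply: eq_bigr => q _; apply: slot_weight.
rewrite -(nth_map None false isSome) ?sv // -[RHS](nth_map None false isSome) ?sv' //.
by rewrite ev.
Qed.

End Grid.
End Family.
End PoissonBells.

(** * Comparison with a cycle *)

Section RefinedGrid.
Variable R : realType.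
Variables (tau : nat -> R) (Q : nat) (U : R).
Hypotheses (tau0 : tau 0%N = 0) (taum : forall a, tau a <= tau a.+1)
  (tauU : forall a, tau a <= U).

(** Each interval between observation times is cut into [Q.+1] equal slots, so that the observation
    times stay on the grid. *)
Definition refined_grid (q : nat) : R :=
  tau (q %/ Q.+1)%N + (tau (q %/ Q.+1).+1 - tau (q %/ Q.+1)%N) * (q %% Q.+1)%:R / Q.+1%:R.

Lemma refined_gridM a : refined_grid (a * Q.+1) = tau a.
Proof. by rewrite /refined_grid mulnK // modnMl mulr0 mul0r addr0. Qed.

Lemma refined_gridB q : refined_grid q.+1 - refined_grid q =
  (tau (q %/ Q.+1).+1 - tau (q %/ Q.+1)%N) / Q.+1%:R.
Proof.
have Qn0 : Q.+1%:R != 0 :> R by rewrite pnatr_eq0.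
rewrite /refined_grid; set a := (q %/ Q.+1)%N; set b := (q %% Q.+1)%N.
have eq : q = (a * Q.+1 + b)%N by exact: divn_eq.
have bQ : (b < Q.+1)%N by rewrite ltn_mod.
have [bQ'|] := ltnP b.+1 Q.+1.
  have -> : (q.+1 %/ Q.+1)%N = a by rewrite eq -addnS divnMDl // (divn_small bQ') addn0.
  have -> : (q.+1 %% Q.+1)%N = b.+1 by rewrite eq -addnS modnMDl modn_small.
  by rewrite -natr1; field; rewrite -natr1 in Qn0.
move=> Qb; have eb : b.+1 = Q.+1 by lia.
have eq1 : q.+1 = (a.+1 * Q.+1 + 0)%N by rewrite eq -addnS eb mulSn addn0 addnC.
have -> : (q.+1 %/ Q.+1)%N = a.+1 by rewrite eq1 divnMDl // div0n addn0.
have -> : (q.+1 %% Q.+1)%N = 0%N by rewrite eq1 modnMDl mod0n.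
have -> : b%:R = Q.+1%:R - 1 :> R by rewrite -eb -natr1 addrK.
by field.
Qed.

Lemma refined_grid_mono q : refined_grid q <= refined_grid q.+1.
Proof. by rewrite -subr_ge0 refined_gridB divr_ge0 ?subr_ge0. Qed.

Lemma refined_grid_mesh q : refined_grid q.+1 - refined_grid q <= U / Q.+1%:R.
Proof.
rewrite refined_gridB ler_pM2r ?invr_gt0 ?ltr0n //.
have : 0 <= tau (q %/ Q.+1)%N.
  by rewrite -tau0; move/nondecreasing_seqP: taum; exact.
by have := tauU (q %/ Q.+1).+1; lra.
Qed.

End RefinedGrid.

Lemma telescope_nat (F : nat -> nat) k : (forall q, F q <= F q.+1)%N ->
  F k = (F 0 + \sum_(q < k) (F q.+1 - F q))%N.
Proof.
move=> h; elim: k => [|k IH]; first by rewrite big_ord0 addn0.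
by rewrite big_ord_recr /= addnA -IH subnKC.
Qed.

Section OutputProcess.
Context {R : realType} {d : measure_display} {T : measurableType d}.
Variable P : probability T R.
Variables (S : countType) (next prev : S -> S) (n : nat).
Hypothesis nextK : cancel next prev.
Variables (N : S -> R -> T -> nat) (X : R -> T -> S * 'I_n -> bool).
Hypothesis hX : is_multiline P next prev N X.
Variable m : 'I_n.
Local Notation k := m.+1.
Let kn : (k <= n)%N := ltn_ord m.

(** The sites are countable, so the exceptional sets of all bells fit into one null set. *)
Lemma exceptional_set : exists B, [/\ measurable B, P B = 0%E &
  forall w, ~ B w ->
    follows_bells (@multiline_jump S next prev n) (fun i t => N i t w) (X ^~ w) /\
    forall i, counting_path (N i ^~ w)].
Proof.
case: hX => hN _ _ hf.
have hc : {ae P, forall w, forall j : nat,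
    if @choice.unpickle S j is Some i then counting_path (N i ^~ w) else True}.
  apply: ae_foralln => j; case: (@choice.unpickle S j) => [i|]; last by apply: nearW.
  by case: (hN i).
have [B [mB B0 hB]] := filterI hf hc.
exists B; split=> // w nBw.
have [h1 h2] : (follows_bells (@multiline_jump S next prev n)
    (fun i t => N i t w) (X ^~ w) /\ forall j : nat,
    if @choice.unpickle S j is Some i then counting_path (N i ^~ w) else True).
  by apply: contrapT => h; apply: nBw; apply: hB.
by split=> // i; have := h2 (@choice.pickle S i); rewrite choice.pickleK.
Qed.

Variable B0 : set T.
Hypotheses (mB0 : measurable B0) (PB0 : P B0 = 0%E).
Hypothesis good : forall w, ~ B0 w ->
    follows_bells (@multiline_jump S next prev n) (fun i t => N i t w) (X ^~ w) /\
    forall i, counting_path (N i ^~ w).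

(* B0 is a null set outside of which the path follows the bells. The value 0 on
   B0 makes line_bells measurable, as P need not be complete. *)
Definition line_bells (j : S) (t : R) (w : T) : nat :=
  if `[< B0 w >] then 0%N
  else output_bells next (fun i t => N i t w) (X ^~ w) k j t.

Lemma line_bellsE j w : ~ B0 w ->
  line_bells j ^~ w = output_bells next (fun i t => N i t w) (X ^~ w) k j.
Proof. by move=> nB; apply/funext => t; rewrite /line_bells asboolF. Qed.

Lemma fiber_measurable_eval (I : countType) (J : Type) (b : T -> I) (x : I -> T -> J) :
  fiber_measurable b -> (forall i, fiber_measurable (x i)) ->
  fiber_measurable (fun w => x (b w) w).
Proof.
move=> mb mx v; rewrite (_ : [set w | _] = [set w | exists i, b w = i /\ x i w = v]).
  by apply: measurable_exists => i; apply: measurableI; [exact: mb|exact: mx].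
by apply/seteqP; split=> w /= => [<-|[i [-> //]]]; exists (b w).
Qed.

Lemma state_fiber t a : 0 <= t -> fiber_measurable (fun w => X t w a).
Proof.
by move=> t0; apply: fiber_measurable_fun => //; case: hX => _ h _ _; exact: h.
Qed.

Lemma bell_site_fiber t i l : 0 <= t -> (l <= n)%N ->
  fiber_measurable (fun w => bell_site next (X t w) i l).
Proof.
move=> t0 ln; rewrite -(subKn ln).
elim: (n - l)%N (leq_subr l n) => [|q IH] qn.
  rewrite subn0 (_ : (fun w => _) = fun=> i); first exact: fiber_measurable_cst.
  by apply/funext => w; rewrite bell_site_bottom.
have lt : (n - q.+1 < n)%N by lia.
pose l' := Ordinal lt.
have el : l'.+1 = (n - q)%N by rewrite /=; lia.
have := IH (ltnW qn); rewrite -el => mb.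
have mx := fiber_measurable_eval mb (fun s => @state_fiber t (s, l') t0).
have -> : (fun w => bell_site next (X t w) i (n - q.+1)) =
    (fun w => if X t w (bell_site next (X t w) i l'.+1, l') == particle
              then bell_site next (X t w) i l'.+1 else next (bell_site next (X t w) i l'.+1)).
  by apply/funext => w; rewrite -[(n - q.+1)%N]/(nat_of_ord l') bell_siteS.
exact: (fiber_measurable_comp2 (fun b v => if v == particle then b else next b) mb mx).
Qed.

Lemma fiber_measurable_flag_count j t q : 0 <= t ->
  fiber_measurable (fun w => flag_count next prev k (fun i t => N i t w) (X ^~ w) j t q).
Proof.
move=> t0; rewrite /flag_count.
have g_ge r : 0 <= uniform_grid t q r by rewrite /uniform_grid divr_ge0 // mulr_ge0.
pose flag r w := slot_flag next prev k (fun i t => N i t w) (X ^~ w) j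
  (uniform_grid t q r) (uniform_grid t q r.+1).
have mflag r : fiber_measurable (flag r).
  rewrite /flag /slot_flag; elim: (iota _ _) => [|u s IH] /=.
    exact: fiber_measurable_cst.
  apply: (fiber_measurable_comp2 orb _ IH).
  apply: (fiber_measurable_comp2 andb).
    apply: (fiber_measurable_comp2 (fun a b : nat => a != b));
      apply: (bells_fiber (P := P)) => //; by case: hX.
  exact: (fiber_measurable_comp (fun b => b == j) (bell_site_fiber _ (g_ge r) kn)).
rewrite (_ : (fun w => _) = (fun w => sumn [seq nat_of_bool b | b <- [seq flag r w | r <- iota 0 q.+1]])).
  apply: (fiber_measurable_comp (fun s => sumn [seq nat_of_bool b | b <- s])).
  by apply: fiber_measurable_seq => r _; exact: mflag.
apply/funext => w; rewrite sumnE !big_map.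
by rewrite -(big_mkord xpredT (fun r => nat_of_bool (flag r w))) /index_iota subn0.
Qed.

(** Off [B0] the count is v iff the slot counts are eventually v, which is a countable union of
    countable intersections. *)
Lemma line_bells_fiber j t : 0 <= t -> fiber_measurable (line_bells j t).
Proof.
move=> t0 v.
have mcst (c : nat) : measurable [set w : T | c = v] by exact: fiber_measurable_cst.
rewrite (_ : [set w | _] = (B0 `&` [set w | 0%N = v]) `|` (~` B0 `&`
   [set w | exists q0, forall q, (q0 <= q)%N ->
      flag_count next prev k (fun i t => N i t w) (X ^~ w) j t q = v])).
  apply: measurableU; first exact: measurableI.
  apply: measurableI; first exact: measurableC.
  apply: measurable_exists => q0; apply: measurable_forall => q.
  case: (boolP (q0 <= q)%N) => h.
    rewrite (_ : [set w | _] = [set w | flag_count next prev k (fun i t => N i t w)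
        (X ^~ w) j t q = v]); first exact: fiber_measurable_flag_count.
    by apply/seteqP; split=> w /=; [exact|].
  by rewrite (_ : [set w | _] = setT) //; apply/seteqP; split.
apply/seteqP; split=> w /=; rewrite /line_bells.
  have [Bw|nB] := asboolP (B0 w) => h; [by left|right; split=> //].
  have [hp hN] := good nB.
  by have [q0 hq] := flag_count_eventually nextK kn hN hp j t0; exists q0 => q /hq ->.
move=> [[Bw <-]|[nB [q0 hq]]]; first by rewrite asboolT.
rewrite asboolF //; have [hp hN] := good nB.
have [q1 hq1] := flag_count_eventually nextK kn hN hp j t0.
by rewrite -(hq1 (maxn q0 q1)) ?leq_maxr // hq ?leq_maxl.
Qed.

Definition config_at M (e : 'I_M -> S) (x : S * 'I_n -> bool) : config M n :=
  [ffun z => x (e z.1, z.2)].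

(* Up to a small probability, the process near J and until time U is that of a
   finite cycle whose initial law is invariant under the jumps. *)
Definition localizable : Prop :=
  forall (U : R) (J : seq S) (eps : R), 0 <= U -> 0 < eps ->
  exists M (e : 'I_M -> S) (B : set T),
  [/\ injective e,
      measurable B /\ (P B <= eps%:E)%E,
      (forall j, j \in J -> exists a, e a = j),
      (forall (c : config M n) a,
        P [set w | config_at e (X 0 w) = cycle_jump k a c] =
        P [set w | config_at e (X 0 w) = c]) &
      forall w, ~ B w -> exists W : 'I_M -> Prop,
        (forall a, e a \in J -> W a) /\
        (forall i, (0 < N i U w)%N -> shielded next prev n e W k i)].

(** The [inl] coordinates are ring counts, the [inr] ones initial values of line m. Their joint law
    contains the law of the bells and their independence of the initial state. *)
Definition coordinate_dom : set (S * R + S) :=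
  [set z | if z is inl (_, t) then 0 <= t else True].

Definition input_coordinate (z : S * R + S) (w : T) : nat :=
  match z with inl (i, t) => N i t w | inr s => X 0 w (s, m) end.

Definition output_coordinate (z : S * R + S) (w : T) : nat :=
  match z with inl (i, t) => line_bells i t w | inr s => X 0 w (s, m) end.

Lemma initial_fiber s : fiber_measurable (fun w => X 0 w (s, m) : nat).
Proof. by apply: (fiber_measurable_comp nat_of_bool); exact: state_fiber. Qed.

Lemma input_fiber z : coordinate_dom z -> fiber_measurable (input_coordinate z).
Proof.
case: z => [[i t] t0|s _]; last exact: initial_fiber.
by apply: (bells_fiber (P := P)) => //; case: hX.
Qed.

Lemma output_fiber z : coordinate_dom z -> fiber_measurable (output_coordinate z).
Proof.
case: z => [[i t] t0|s _]; last exact: initial_fiber.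
exact: line_bells_fiber.
Qed.


Lemma nth_grid (ts : seq R) : (forall t, t \in ts -> 0 <= t) ->
  exists tau U, [/\ tau 0%N = 0, forall a, tau a <= tau a.+1, forall a, tau a <= U,
    0 <= U & exists r, forall t, t \in ts -> exists2 a, (a <= r)%N & tau a = t].
Proof.
move=> hts; pose U := \sum_(t <- ts) t.
have hU t : t \in ts -> t <= U.
  move=> tts; rewrite /U (big_rem t) //= lerDl big_seq.
  by apply: sumr_ge0 => u /mem_rem /hts.
pose s := 0 :: sort <=%R ts.
have U0 : 0 <= U by rewrite /U big_seq; apply: sumr_ge0 => u /hts.
have ss : sorted <=%R s.
  rewrite /s /= path_min_sorted ?sort_le_sorted //.
  by apply/allP => t; rewrite mem_sort => /hts.
have sU t : t \in s -> t <= U by rewrite inE mem_sort => /orP[/eqP ->|/hU].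
have nthU a : nth U s a <= U.
  have [h|h] := ltnP a (size s); first by apply/sU/mem_nth.
  by rewrite nth_default.
(* The default value [U] continues the finite list of times as a nondecreasing sequence. *)
exists (nth U s), U; split=> //.
  move=> a; have [h|h] := ltnP a.+1 (size s); last by rewrite (nth_default _ h).
  by have /(sortedP U) := ss; apply.
exists (size s) => t tts.
have ts' : t \in s by rewrite inE mem_sort tts orbT.
by exists (index t s); [rewrite index_size|exact: nth_index].
Qed.

Hypothesis loc : localizable.

Section Cells.
Variables (M : nat) (e : 'I_M -> S) (g : nat -> R) (K : nat) (idx : R -> nat).
Hypothesis einj : injective e.
Hypotheses (g0 : g 0%N = 0) (gm : forall q, g q <= g q.+1).

Definition cell (z : config M n * K.-tuple (option 'I_M)) : set T :=
  slot_cell N e g K [set w | config_at e (X 0 w) = z.1] z.2.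

Lemma chain_run_size (z : config M n * K.-tuple (option 'I_M)) :
  size (chain_run k z.1 z.2).2 == K.
Proof. by rewrite size_chain_run size_tuple. Qed.

(** The final configuration takes the place of the initial one. Nothing is lost: the initial law is
    invariant under the jumps, and line m does not change along the run. *)
Definition chain_map (z : config M n * K.-tuple (option 'I_M)) :
    config M n * K.-tuple (option 'I_M) :=
  ((chain_run k z.1 z.2).1, Tuple (chain_run_size z)).

Lemma chain_map_inj : injective chain_map.
Proof.
move=> [c v] [c' v'] [e1 e2].
have [|-> ev] := @chain_run_inj M n k kn c c' v v'.
  by rewrite [LHS]surjective_pairing [RHS]surjective_pairing e1 e2.
by congr pair; apply/val_inj.
Qed.

Definition cell_value (y : S * R + S) (z : config M n * K.-tuple (option 'I_M)) : nat :=
  match y with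
  | inl (i, t) => \sum_(q < idx t) (omap e (nth None z.2 q) == Some i)
  | inr s => [exists a, (e a == s) && z.1 (a, m)]
  end.

Lemma omap_eq_inj a v : (omap e v == Some (e a)) = (v == Some a).
Proof. by case: v => //= b; rewrite !(inj_eq Some_inj) (inj_eq einj). Qed.

Lemma config_at_family c :
  g_sigma_family [set: S * 'I_n] (fun l w => X 0 w l) [set w | config_at e (X 0 w) = c].
Proof.
rewrite (_ : [set w | _] = [set w | forall z : 'I_M * 'I_n, X 0 w (e z.1, z.2) = c z]).
  apply: (@measurable_forall _ (g_sigma_algebraType _)) => z.
  exact: (@family_fiber _ _ (S * 'I_n) R _ bool setT (fun l w => X 0 w l) (e z.1, z.2) (fun _ => Logic.I) Logic.I).
apply/seteqP; split=> w /=; first by move=> <- z; rewrite ffunE.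
by move=> h; apply/ffunP => z; rewrite ffunE h.
Qed.

Lemma measurable_cell z : measurable (cell z).
Proof.
case: hX => hN mX _ _; apply: measurableI.
  rewrite (_ : [set w | _] = [set w | forall y : 'I_M * 'I_n, X 0 w (e y.1, y.2) = z.1 y]).
    by apply: measurable_forall => y; exact: state_fiber.
  apply/seteqP; split=> w /=; first by move=> <- y; rewrite ffunE.
  by move=> h; apply/ffunP => y; rewrite ffunE h.
apply: measurable_forall => a; apply: measurable_forall => q.
by apply: (increment_fm hN) => //; rewrite g0.
Qed.

Lemma trivIset_cell : trivIset setT cell.
Proof.
move=> [c v] [c' v'] _ _ [w [[/= <- h] [/= <- h']]]; congr pair.
apply/val_inj/(@eq_from_nth _ None); rewrite ?size_tuple // => q qK.
have hv a : (nth None v q == Some a) = (nth None v' q == Some a).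
  have := h a (Ordinal qK); have := h' a (Ordinal qK) => /= -> /=.
  by case: (_ == _); case: (_ == _).
case ev : (nth None v q) => [a|].
  by have := hv a; rewrite ev eqxx => /esym/eqP.
case ev' : (nth None v' q) => [a|//].
by have := hv a; rewrite ev ev' eqxx.
Qed.

(** The configuration keeps its weight by invariance under [cycle_jump], the pattern because the
    same slots contain a ring before and after. *)
Lemma measure_chain_map :
  (forall (c : config M n) a, P [set w | config_at e (X 0 w) = cycle_jump k a c] =
        P [set w | config_at e (X 0 w) = c]) ->
  forall z, P (cell (chain_map z)) = P (cell z).
Proof.
move=> hc [c v]; case: hX => hN _ hI _.
rewrite /cell /=.
apply: (measure_slot_cell hN hI einj) => //; rewrite ?g0 //.
- exact: config_at_family.
- exact: config_at_family.
- exact: (@chain_run_invariant M n k _ (fun c => P [set w | config_at e (X 0 w) = c])).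
- by rewrite size_chain_run size_tuple.
- exact: chain_run_isSome.
Qed.

Lemma chain_map_above (z : config M n * K.-tuple (option 'I_M)) s :
  cell_value (inr s) (chain_map z) = cell_value (inr s) z.
Proof.
rewrite /=; congr nat_of_bool; apply: eq_existsb => a.
by rewrite chain_run_above.
Qed.

Variables (U : R) (w : T) (W : 'I_M -> Prop).
Hypotheses (gU : g K <= U) (nB0 : ~ B0 w).
Hypothesis hW : forall i, (0 < N i U w)%N -> shielded next prev n e W k i.

Lemma cell_input y z : cell z w ->
  match y with inl (i, t) => [/\ g (idx t) = t, (idx t <= K)%N & exists a, e a = i]
             | inr s => exists a, e a = s end ->
  input_coordinate y w = cell_value y z.
Proof.
move=> [hc hv]; case: y => [[i t] [gt tK [a ea]]|s [a ea]] /=.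
  have [_ /(_ i) [Ni0 Nm _]] := good nB0.
  rewrite -[in LHS]gt (@telescope_nat (fun q => N i (g q) w)); last first.
    by move=> q; apply: Nm => //; rewrite -g0; move/nondecreasing_seqP: gm; exact.
  rewrite g0 Ni0 add0n; apply: eq_bigr => q _.
  have qK : (q < K)%N by apply: leq_trans tK; exact: ltn_ord.
  by have := hv a (Ordinal qK); rewrite /increment ea /= => ->; rewrite -ea omap_eq_inj.
congr nat_of_bool; rewrite -hc; apply/idP/existsP => [Xs|[a' /andP[/eqP <-]]].
  by exists a; rewrite ea eqxx ffunE /= ea.
by rewrite ffunE.
Qed.

(** Slot by slot, [grid_run] identifies the output with that of the chain, but only at sites of [W],
    where path and chain agree. *)
Lemma cell_output y z : cell z w ->
  match y with inl (i, t) => [/\ g (idx t) = t, (idx t <= K)%N & exists2 a, W a & e a = i]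
             | inr s => exists a, e a = s end ->
  output_coordinate y w = cell_value y (chain_map z).
Proof.
move=> hz; case: y => [[i t] [gt tK [a Wa ea]]|s [a ea]]; last first.
  by rewrite chain_map_above -cell_input //; exists a.
have [hc hv] := hz; have [hp hN] := good nB0.
have hout j := output_counting nextK (X ^~ w) hN kn j.
rewrite /= /line_bells asboolF //.
have [out0 outm _] := hout i.
rewrite -[in LHS]gt (@telescope_nat (fun q => output_bells next _ (X ^~ w) k i (g q))); last first.
  by move=> q; apply: outm => //; rewrite -g0; move/nondecreasing_seqP: gm; exact.
rewrite g0 out0 add0n; apply: eq_bigr => q _.
have qK : (q < K)%N by apply: leq_trans tK; exact: ltn_ord.
have := @grid_run R S next prev n nextK _ _ hN hp k kn M e einj W U hW g z.2 0 z.1.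
rewrite g0 lexx add0n size_tuple => /(_ isT gm gU) H.
have := H _ _ q a qK Wa; rewrite add0n ea => -> //.
- by rewrite -ea omap_eq_inj.
- by move=> q' a' q'K; rewrite add0n; exact: (hv a' (Ordinal q'K)).
- by move=> a' l _ _; rewrite -hc ffunE.
Qed.

End Cells.


Definition coordinate_site (y : S * R + S) : S :=
  match y with inl (i, _) => i | inr s => s end.

Definition coordinate_time (y : S * R + S) : R := if y is inl (_, t) then t else 0.

(** The cycle is fixed before the grid: its size M enters the bound on crowded slots, and the grid
    is refined accordingly. *)
Lemma output_law_approx (l : seq ((S * R + S) * nat)) (eps : R) : 0 < eps ->
  (forall z, List.In z l -> coordinate_dom z.1) ->
  (P [set w | forall z, List.In z l -> input_coordinate z.1 w = z.2] <=
   P [set w | forall z, List.In z l -> output_coordinate z.1 w = z.2] + eps%:E)%E /\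
  (P [set w | forall z, List.In z l -> output_coordinate z.1 w = z.2] <=
   P [set w | forall z, List.In z l -> input_coordinate z.1 w = z.2] + eps%:E)%E.
Proof.
move=> eps0 Dl.
have inl_map (B : eqType) (h : S * R + S -> B) z : List.In z l -> h z.1 \in [seq h z.1 | z <- l].
  elim: (l) => //= a l' IH [->|/IH]; first by rewrite mem_head.
  by rewrite inE => ->; rewrite orbT.
pose ts := [seq coordinate_time z.1 | z <- l].
have ts0 t : t \in ts -> 0 <= t.
  move=> /mapP[z zl ->]; have : List.In z l.
    elim: (l) zl => //= a l' IH; rewrite inE => /orP[/eqP ->|/IH]; [by left|by right].
  by move=> /Dl; case: z.1 => [[]|].
have [tau [U [tau0 taum tauU U0 [r htau]]]] := nth_grid ts0.
have /choice[f hf] : forall t, exists a, t \in ts -> (a <= r)%N /\ tau a = t.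
  move=> t; have [tts|] := boolP (t \in ts); last by exists 0%N.
  by have [a ar ta] := htau t tts; exists a.
(* Localization and crowded slots cost eps / 4 each, and [finite_transfer] uses [P B] twice. *)
have [] := @loc U [seq coordinate_site z.1 | z <- l] (eps / 4) U0; first by lra.
move=> M [e [B2 [einj [mB2 PB2] eJ hc hW]]].
(* With $K=r(Q+1)$ slots of length at most $U/(Q+1)$, the bound of [measure_crowded] is $C/(Q+1)$,
   at most eps / 4 for the [Q] below. *)
pose C := r%:R * M%:R ^+ 2 * U ^+ 2 : R.
pose Q := Num.truncn (C / (eps / 4)).
pose g := refined_grid tau Q; pose K := (r * Q.+1)%N.
pose idx t := (f t * Q.+1)%N.
have g0 : g 0%N = 0 by rewrite /g -(mul0n Q.+1) refined_gridM.
have gm := refined_grid_mono Q taum.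
have gmesh := refined_grid_mesh Q tau0 taum tauU.
case: (hX) => hN _ hI _.
have g00 : 0 <= g 0%N by rewrite g0.
have mcr := measurable_crowded hN e K g00 gm.
have Pcr : (P [set w | crowded N e g K w] <= (eps / 4)%:E)%E.
  apply: (le_trans (measure_crowded hN hI einj K g00 gm gmesh)); rewrite lee_fin.
  have Q0 : 0 < Q.+1%:R :> R by rewrite ltr0n.
  have -> : K%:R * M%:R ^+ 2 * (U / Q.+1%:R) ^+ 2 = C / Q.+1%:R.
    by rewrite /C /K natrM; field; rewrite gt_eqF.
  rewrite ler_pdivrMr // mulrC -ler_pdivrMr; last by lra.
  exact/ltW/Num.Theory.truncnS_gt.
pose B := (B0 `|` B2) `|` [set w | crowded N e g K w].
have mB02 : measurable (B0 `|` B2) by exact: measurableU.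
have mB : measurable B by exact: measurableU.
have PB : (P B <= (eps / 2)%:E)%E.
  apply: (le_trans (measureU2 _ _ _)) => //.
  have -> : eps / 2 = eps / 4 + eps / 4 by lra.
  rewrite EFinD; apply: leeD => //.
  apply: (le_trans (measureU2 _ _ _)) => //.
  by rewrite [X in (X + _)%E]PB0 add0e.
have mA (h : S * R + S -> T -> nat) : (forall z, coordinate_dom z -> fiber_measurable (h z)) ->
    measurable [set w | forall z, List.In z l -> h z.1 w = z.2].
  move=> mh; apply: (@measurable_cylinder_preimage _ _ _ coordinate_dom h
    [set p | forall z, List.In z l -> p z.1 = z.2] mh).
  by apply: sub_sigma_algebra; exists l.
have PB2' : (P B + P B <= eps%:E)%E.
  by have -> : eps = eps / 2 + eps / 2 by [lra]; rewrite EFinD; exact: leeD.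
pose good_cell (z : config M n * K.-tuple (option 'I_M)) : bool :=
  `[< forall y, List.In y l -> cell_value e idx y.1 z = y.2 >].
have hdom y : List.In y l -> if y.1 is inl (i, t) then g (idx t) = t /\ (idx t <= K)%N else True.
  move=> yl; have := inl_map _ coordinate_time y yl; have := hf (coordinate_time y.1).
  case: y.1 => [[i t]|] //= h /h[h1 h2]; split; last by rewrite leq_mul2r h1 orbT.
  by rewrite /g refined_gridM.
have gK : g K <= U by rewrite /g refined_gridM.
have [||||||||a1 a2] := @finite_transfer R _ T P _ (@cell M e g K)
  (@measurable_cell M e g K g0 gm) (@trivIset_cell M e g K) (@chain_map M K)
  [set w | forall z, List.In z l -> input_coordinate z.1 w = z.2]
  [set w | forall z, List.In z l -> output_coordinate z.1 w = z.2] B good_cell.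
- exact: chain_map_inj.
- exact: measure_chain_map.
- exact: (mA _ input_fiber).
- exact: (mA _ output_fiber).
- exact: mB.
- move=> w nB; have ncr : ~ crowded N e g K w by move=> h; apply: nB; right.
  have /choice[v hv] : forall q, exists v : option 'I_M, (q < K)%N ->
      forall a, increment N g (e a) q w = (v == Some a).
    move=> q; have [qK|] := boolP (q < K)%N; last by exists None.
    by have [v hv] := not_crowded ncr qK; exists v.
  exists (config_at e (X 0 w), [tuple v i | i < K]); split=> //= a q.
  by rewrite (nth_map q) ?size_enum_ord // nth_ord_enum hv.
- move=> w z nB hz; split=> /= [h|/asboolP h].
    apply/asboolP => y yl; rewrite -(@cell_input M e g K idx einj g0 gm w _ y.1 z hz) ?h //.
      by move=> Bw; apply: nB; left; left.
    have := hdom y yl; have := inl_map _ coordinate_site y yl.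
    by case: y.1 => [[i t]|s] /eJ [a ea] => [[h1 h2]|_]; [split=> //; exists a|exists a].
  move=> y yl; rewrite (@cell_input M e g K idx einj g0 gm w _ y.1 z hz) ?h //.
    by move=> Bw; apply: nB; left; left.
  have := hdom y yl; have := inl_map _ coordinate_site y yl.
  by case: y.1 => [[i t]|s] /eJ [a ea] => [[h1 h2]|_]; [split=> //; exists a|exists a].
- move=> w z nB hz.
  have nB0 : ~ B0 w by move=> h; apply: nB; left; left.
  have nB2 : ~ B2 w by move=> h; apply: nB; left; right.
  have [W [WJ Wsh]] := hW w nB2.
  have hout y : List.In y l -> output_coordinate y.1 w = cell_value e idx y.1 (chain_map z).
    move=> yl; apply: (@cell_output M e g K idx einj g0 gm U w W) => //.
    have := hdom y yl; have := inl_map _ coordinate_site y yl.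
    case: y.1 => [[i t]|s] /= hJ; have [a ea] := eJ _ hJ; last by exists a.
    by move=> [h1 h2]; split=> //; exists a => //; apply: WJ; rewrite ea.
  split=> /= [h|/asboolP h]; first by apply/asboolP => y yl; rewrite -hout ?h.
  by move=> y yl; rewrite hout ?h.
split; first by apply: (le_trans a1); exact: leeD.
by apply: (le_trans a2); exact: leeD.
Qed.

Lemma output_law (l : seq ((S * R + S) * nat)) :
  (forall z, List.In z l -> coordinate_dom z.1) ->
  P [set w | forall z, List.In z l -> input_coordinate z.1 w = z.2] =
  P [set w | forall z, List.In z l -> output_coordinate z.1 w = z.2].
Proof.
move=> Dl; apply/eqP; rewrite eq_le; apply/andP; split; apply/lee_addgt0Pr => eps eps0.
  by have [] := output_law_approx eps0 Dl.
by have [] := output_law_approx eps0 Dl.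
Qed.


Local Notation same := (same_event coordinate_dom input_coordinate output_coordinate).

Lemma same_measure E E' : same E E' -> P E = P E'.
Proof. exact: (same_event_measure input_fiber output_fiber output_law). Qed.

Lemma same_line_bells j (t : R) (B : set nat) : 0 <= t ->
  same [set w | B (N j t w)] [set w | B (line_bells j t w)].
Proof.
move=> t0; apply: (@same_event_fun _ _ _ coordinate_dom input_coordinate output_coordinate
  [:: inl (j, t)] (fun s => B (head 0%N s))).
by move=> _ [<-|[]].
Qed.

Lemma same_line_bells_increment j (s t : R) (B : set nat) : 0 <= s -> 0 <= t ->
  same [set w | B (N j t w - N j s w)%N] [set w | B (line_bells j t w - line_bells j s w)%N].
Proof.
move=> s0 t0; apply: (@same_event_fun _ _ _ coordinate_dom input_coordinate output_coordinate
  [:: inl (j, t); inl (j, s)] (fun x => B (nth 0%N x 0 - nth 0%N x 1)%N)).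
by move=> _ [<-|[<-|[]]].
Qed.

Lemma same_initial s (B : set bool) :
  same [set w | B (X 0 w (s, m))] [set w | B (X 0 w (s, m))].
Proof.
have := @same_event_fun _ _ _ coordinate_dom input_coordinate output_coordinate
  [:: inr s] (fun x => B (head 0%N x == 1%N)).
have -> : [set w | B (head 0%N [seq input_coordinate i w | i <- [:: inr s]] == 1%N)] =
    [set w | B (X 0 w (s, m))] by apply/seteqP; split=> w /=; case: (X _ _ _).
by apply=> _ [<-|[]].
Qed.

Lemma line_bells_poisson j : rate1_poisson_process P (line_bells j).
Proof.
case: (hX) => hN _ _ _; have [_ _ Ninc Nind] := hN j; split.
- move=> t t0; apply: measurable_fun_fiber; first exact: countableP.
  exact: line_bells_fiber.
- exists B0; split=> // w /= nh; apply: contrapT => nB; apply: nh.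
  rewrite line_bellsE //; apply: output_counting => //.
  by have [] := good nB.
- move=> s t k' s0 st.
  by rewrite -(same_measure (same_line_bells_increment j [set k'] s0 _)) ?Ninc //; lra.
- move=> t t0 tm s E us hE.
  have t_ge q : 0 <= t q by apply: (le_trans t0); move/nondecreasing_seqP: tm; exact.
  have /choice[B hB] : forall q, exists B : set nat, q \in s ->
      E q = [set w | B (line_bells j (t q.+1) w - line_bells j (t q) w)%N].
    move=> q; have [qs|] := boolP (q \in s); last by exists set0.
    by have [B _ <-] := hE q qs; exists B; rewrite setTI.
  pose E' q := [set w | B q (N j (t q.+1) w - N j (t q) w)%N].
  have sE q : q \in s -> same (E' q) (E q).
    by move=> qs; rewrite hB //; exact: same_line_bells_increment.
  rewrite -(same_measure (same_event_bigcap sE)) (Nind t t0 tm) //; last first.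
    by move=> q _; exists (B q) => //; rewrite setTI.
  by rewrite !big_seq; apply: eq_bigr => q /sE /same_measure.
Qed.

(** Every event of the new bell has a counterpart generated by [N j], to which the independence of
    the original bells applies. *)
Lemma line_bells_family j E : g_sigma_family [set t : R | 0 <= t] (line_bells j) E ->
  exists E', g_sigma_family [set t : R | 0 <= t] (N j) E' /\ same E' E.
Proof.
pose TN := g_sigma_algebraType (\bigcup_(t in [set t : R | 0 <= t])
  g_sigma_algebra_preimage (N j t)).
move: E; apply: smallest_sub.
  split.
  - exists set0; split; first exact: (@measurable0 _ TN).
    have := same_event_bigcup (fun _ : nat => same_line_bells j set0 (lexx 0)).
    by rewrite !bigcup_const //; exists 0%N.
  - move=> A [E' [mE' sE']]; exists (~` E'); split; first exact: (@measurableC _ TN).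
    by rewrite setTD; exact: same_eventC.
  - move=> F /choice[E' hE']; exists (\bigcup_q E' q); split.
      by apply: (@bigcupT_measurable _ TN) => q; case: (hE' q).
    by apply: same_event_bigcup => q; case: (hE' q).
move=> E [t t0 [B _ <-]]; exists [set w | B (N j t w)]; split.
  by apply: sub_sigma_algebra; exists t => //; exists B => //; rewrite setTI.
by rewrite setTI; exact: same_line_bells.
Qed.

Lemma line_initial_family E :
  g_sigma_family [set: S] (fun l w => line_process X m 0 w l) E ->
  g_sigma_family [set: S * 'I_n] (fun l w => X 0 w l) E /\ same E E.
Proof.
pose TX := g_sigma_algebraType (\bigcup_(l in [set: S * 'I_n])
  g_sigma_algebra_preimage (fun w => X 0 w l)).
move: E; apply: smallest_sub.
  split.
  - split; first exact: (@measurable0 _ TX).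
    exists set0; split; first exact: (@measurable0 _ (g_sigma_algebraType _)).
    by split.
  - move=> A [mA sA]; rewrite setTD; split; first exact: (@measurableC _ TX).
    exact: same_eventC.
  - move=> F hF; split.
      by apply: (@bigcupT_measurable _ TX) => q; case: (hF q).
    by apply: same_event_bigcup => q; case: (hF q).
move=> E [s _ [B _ <-]]; rewrite setTI; split; last exact: same_initial.
by apply: sub_sigma_algebra; exists (s, m) => //; exists B => //; rewrite setTI.
Qed.

Lemma line_is_tasep : is_tasep P prev line_bells (line_process X m).
Proof.
case: (hX) => hN mX hI _; split.
- exact: line_bells_poisson.
- by move=> t l t0; exact: mX.
- move=> s E us hE.
  have /choice[E' hE'] : forall o, exists E', o \in s ->
      match o with
      | Some i => g_sigma_family [set t : R | 0 <= t] (N i) E'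
      | None => g_sigma_family [set: S * 'I_n] (fun l w => X 0 w l) E'
      end /\ same E' (E o).
    move=> o; have [os|] := boolP (o \in s); last by exists set0.
    case: o os => [i|] os.
      by have [E' ?] := line_bells_family (hE _ os); exists E'.
    by exists (E None) => _; exact: line_initial_family (hE _ os).
  have sE o : o \in s -> same (E' o) (E o) by move=> /hE'[].
  rewrite -(same_measure (same_event_bigcap sE)) hI //; last by move=> [i|] /hE'[].
  by rewrite !big_seq; apply: eq_bigr => o /sE /same_measure.
- exists B0; split=> // w /= nh; apply: contrapT => nB; apply: nh.
  have [hp hc] := good nB.
  have := line_follows_output nextK hc hp kn erefl.
  rewrite (_ : (fun i t => line_bells i t w) =
    output_bells next (fun i t => N i t w) (X ^~ w) k) //.
  by apply/funext => i; exact: line_bellsE.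
Qed.

End OutputProcess.

Lemma localizable_tasep_law (R : realType) (d : measure_display) (T : measurableType d)
    (P : probability T R) (S : countType) (next prev : S -> S) (n : nat)
    (N : S -> R -> T -> nat) (X : R -> T -> S * 'I_n -> bool) (m : 'I_n) :
  cancel next prev -> is_multiline P next prev N X ->
  localizable P next prev N X m ->
  has_tasep_law prev P (line_process X m).
Proof.
move=> nextK hX loc; have [B0 [mB0 PB0 good]] := exceptional_set hX.
(* The TASEP lives on the given probability space: its path is line m itself and its bells are those
   that the line hears, so equality of laws is immediate. *)
exists d, T, P, (line_bells next N X m B0), (line_process X m); split=> //.
exact: line_is_tasep.
Qed.

(** * The cycle and the line *)

(** The permutation may depend on [c]: it only has to carry counts and weights from [c] to its
    image. *)
Lemma cycle_jump_perm M n k a (c : config M n) (l : 'I_n) :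
  exists s : {perm 'I_M}, forall i, cycle_jump k a c (i, l) = c (s i, l).
Proof.
have [kl|lk] := leqP k l; last first.
  by exists 1%g => i; rewrite ffunE /partial_jump /= leqNgt lk perm1.
pose b := bell_site (@ordS M) c a l.+1.
have [h|h] := tasep_jump_tperm (@ord_pred M) b (fun j => c (j, l)).
  by exists 1%g => i; rewrite ffunE /partial_jump /= kl /multiline_jump /= h perm1.
exists (tperm b (ord_pred b)) => i.
rewrite ffunE /partial_jump /= kl /multiline_jump /= h; congr (c (_, _)).
by rewrite permE.
Qed.

Section Cycle.
Context {R : realType} {d : measure_display} {T : measurableType d}.
Variable P : probability T R.
Variables (N n : nat) (bells : 'I_N -> R -> T -> nat) (X : R -> T -> 'I_N * 'I_n -> bool).
Variables (q : 'I_n -> nat) (m : 'I_n).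

Lemma cycle_jump_configs k a (c : config N n) :
  (cycle_jump k a c \in cycle_configs N q) = (c \in cycle_configs N q).
Proof.
rewrite !inE; apply: eq_forallb => l.
have [s hs] := cycle_jump_perm k a c l; congr (_ == _).
rewrite -!sum1_card [RHS](reindex_inj (@perm_inj _ s)).
by apply: eq_bigl => i; rewrite unfold_in [in RHS]unfold_in /= /in_set /mkset /= hs.
Qed.

(** The cycle is the set of sites itself, [W] is everything and every bell is inner. Jumps neither
    enter nor leave the set of configurations with given counts, so the uniform law is invariant. *)
Lemma localizable_cycle : uniform_initial P q (X 0) ->
  localizable P (@ordS N) (@ord_pred N) bells X m.
Proof.
move=> hq U J eps U0 eps0; exists N, id, set0; split=> //.
- by rewrite measure0 lee_fin ltW.
- by move=> j _; exists j.
- have e (c : config N n) : [set w | config_at id (X 0 w) = c] = [set w | forall a, X 0 w a = c a].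
    apply/seteqP; split=> w /=; first by move=> <- [i l]; rewrite ffunE.
    by move=> h; apply/ffunP => -[i l]; rewrite ffunE h.
  by move=> c a; rewrite !e !hq cycle_jump_configs.
- move=> w _; exists (fun _ => True); split=> // i _; left; exists i.
  exact: (@inner_bellP _ (@ordS N) (@ord_pred N) n N id).
Qed.

End Cycle.

(** * Product measure and silent blocks on the line *)

Section Line.
Context {R : realType} {d : measure_display} {T : measurableType d}.
Variable P : probability T R.
Variable n : nat.

Section ProductMeasure.
Variables (X : R -> T -> int * 'I_n -> bool) (rho : 'I_n -> R).
Hypothesis mX : forall a, measurable_fun setT (fun w => X 0 w a).
Hypothesis hX : product_initial P rho (X 0).
Variables (M : nat) (e : 'I_M -> int).
Hypothesis einj : injective e.

Lemma initial_event_measurable a b : measurable [set w | X 0 w a = b].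
Proof. exact: (fiber_measurable_fun _ (mX a)). Qed.

Lemma initial_law i i' l b :
  P [set w | X 0 w (i, l) = b] = P [set w | X 0 w (i', l) = b].
Proof.
case: hX => _ hp.
case: b; last by rewrite (hp i l) (hp i' l).
have e1 j : [set w | X 0 w (j, l) = true] = ~` [set w | X 0 w (j, l) = particle].
  by apply/seteqP; split=> w /=; case: (X 0 w _).
rewrite !e1 !probability_setC ?hp //; exact: initial_event_measurable.
Qed.

(** Marginals depend on the line only; with all of them taken at site 0, the product over a line is
    visibly invariant under permutations of its sites. *)
Lemma config_law (c : config M n) :
  P [set w | config_at e (X 0 w) = c] =
  (\prod_(l < n) \prod_(i < M) P [set w | X 0%R w (0%R, l) = c (i, l)])%E.
Proof.
case: hX => hI _.
pose F (z : 'I_M * 'I_n) := (e z.1, z.2).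
have Finj : injective F by move=> [i l] [i' l'] [/einj -> ->].
pose E a := [set w | forall z, F z = a -> X 0 w a = c z].
have -> : [set w | config_at e (X 0 w) = c] = \bigcap_(a in [set` map F (enum {: 'I_M * 'I_n})]) E a.
  apply/seteqP; split=> w /=.
    by move=> ec _ /mapP[z _ ->] z' /Finj ->; rewrite -ec ffunE.
  move=> h; apply/ffunP => z; rewrite ffunE.
  by apply: (h (F z)) => //; rewrite /= map_f // mem_enum.
have EF z : E (F z) = [set w | X 0 w (F z) = c z].
  by apply/seteqP; split=> w /=; [apply|move=> h z' /Finj ->].
rewrite hI.
- rewrite big_map big_enum /= exchange_big pair_bigA /=; apply: eq_bigr => -[i l] _.
  by rewrite EF; exact: initial_law.
- by rewrite map_inj_uniq // enum_uniq.
- by move=> _ /mapP[z _ ->]; rewrite EF; exists [set c z] => //; rewrite setTI.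
Qed.

Lemma config_law_jump k a (c : config M n) :
  P [set w | config_at e (X 0 w) = cycle_jump k a c] =
  P [set w | config_at e (X 0 w) = c].
Proof.
rewrite !config_law; apply: eq_bigr => l _.
have [s hs] := cycle_jump_perm k a c l.
by rewrite [RHS](reindex_inj (@perm_inj _ s)); apply: eq_bigr => i _; rewrite hs.
Qed.

End ProductMeasure.

Lemma probability_setD_sub (A B : set T) : measurable A -> measurable B ->
  B `<=` A -> P (A `\` B) = (P A - P B)%E.
Proof.
move=> mA mB BA; rewrite measureD // ?(setIidr BA) //.
by rewrite (le_lt_trans (probability_le1 P mA)) // ltry.
Qed.

(** Complements are introduced one at a time, by $P(D\cap A^c)=P(D)-P(D\cap A)$. *)
Lemma independent_complements (A : nat -> set T) (p : nat -> R) :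
  (forall r, measurable (A r)) ->
  (forall t, uniq t -> P (\bigcap_(r in [set` t]) A r) = (\prod_(r <- t) p r)%:E) ->
  forall s t, uniq (s ++ t) ->
  P (\bigcap_(r in [set` s]) ~` A r `&` \bigcap_(r in [set` t]) A r) =
  (\prod_(r <- s) (1 - p r) * \prod_(r <- t) p r)%:E.
Proof.
move=> mA hA; elim=> [|r s IH] t; rewrite ?cat_cons.
  move=> ut; rewrite big_nil mul1r -hA // (_ : \bigcap_(_ in _) _ = setT) ?setTI //.
  by apply/seteqP; split=> // w _ i.
move=> urst; have ust : uniq (s ++ t) by move: urst => /= /andP[].
have urst' : uniq (s ++ r :: t) by rewrite -(cat1s r t) uniq_catCA.
rewrite big_cons.
have -> : \bigcap_(i in [set` r :: s]) ~` A i `&` \bigcap_(i in [set` t]) A i =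
   (\bigcap_(i in [set` s]) ~` A i `&` \bigcap_(i in [set` t]) A i) `\`
   (\bigcap_(i in [set` s]) ~` A i `&` \bigcap_(i in [set` r :: t]) A i).
  apply/seteqP; split=> w /=.
    move=> [h1 h2]; split.
      by split=> // i is_; apply: h1; rewrite /= inE is_ orbT.
    by move=> [_ h3]; apply: (h1 r); [rewrite /= mem_head|apply: h3; rewrite /= mem_head].
  move=> [[h1 h2] h3]; split=> // i; rewrite /= inE => /orP[/eqP ->|]; last exact: h1.
  move=> Ar; apply: h3; split=> // j; rewrite /= inE => /orP[/eqP -> //|]; exact: h2.
have mC (s' : seq nat) : measurable (\bigcap_(i in [set` s']) ~` A i).
  by apply: bigcap_seq_measurable => i; exact: measurableC.
have mI (t' : seq nat) : measurable (\bigcap_(i in [set` t']) A i).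
  exact: bigcap_seq_measurable.
have mCI (s' t' : seq nat) : measurable (\bigcap_(i in [set` s']) ~` A i `&` \bigcap_(i in [set` t']) A i).
  exact: measurableI.
rewrite probability_setD_sub // => [|w [h1 h2]]; last first.
  by split=> // i it_; apply: h2; rewrite /= inE it_ orbT.
rewrite (IH _ ust) (IH _ urst') -EFinB big_cons.
by congr (_%:E); ring.
Qed.

(** Disjoint blocks of n + 1 sites are independent, and each is silent with the same probability
    $p_0>0$. So $x=1-p_0$ works for all K. *)
Lemma no_silent_block (S : choiceType) (L : Type) (N : S -> R -> T -> nat)
    (X0 : T -> L -> bool) (U : R) (sigma : nat -> S) :
  0 <= U -> (forall i, rate1_poisson_process P (N i)) ->
  mutually_independent P (fun o : option S =>
        match o with
        | Some i => g_sigma_family [set t : R | 0 <= t] (N i)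
        | None => g_sigma_family [set: L] (fun l w => X0 w l)
        end) ->
  injective sigma ->
  exists2 x : R, 0 <= x < 1 & forall K,
    measurable [set w | forall r : 'I_K, exists s : 'I_n.+1,
      (0 < N (sigma (r * n.+1 + s)) U w - N (sigma (r * n.+1 + s)) 0%R w)%N] /\
    (P [set w | forall r : 'I_K, exists s : 'I_n.+1,
      (0 < N (sigma (r * n.+1 + s)) U w - N (sigma (r * n.+1 + s)) 0%R w)%N] <=
     (x ^+ K)%:E)%E.
Proof.
move=> U0 hN hI sinj.
pose sil i := [set w | (N i U w - N i 0%R w)%N = 0%N].
have Psil i : P (sil i) = (increment_pmf U 0)%:E.
  by rewrite /sil (increment_law (hN i)) ?subr0 // lexx U0.
have msil i : measurable (sil i) by apply: (increment_fiber (hN i)).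
have fsil i : g_sigma_family [set t : R | 0 <= t] (N i) (sil i).
  have fm t : 0 <= t -> _ := fun h => @family_fiber _ _ R unit _ nat [set t : R | 0 <= t]
    (N i) t (fun _ => Logic.I) h.
  exact: (fiber_measurable_comp2 subn (fm _ U0) (fm _ (lexx 0)) 0%N).
(* This is $e^{-(n+1)U}$, also for U = 0, when no bell has rung. *)
pose p0 : R := increment_pmf U 0 ^+ n.+1.
have pmf01 : 0 < increment_pmf U 0 <= 1.
  rewrite /increment_pmf; case: ifP => [Up|_]; last by rewrite ltr01 lexx.
  rewrite /poisson_pmf Up expr0 mul1r fact0 invr1 mul1r expR_gt0 /=.
  by rewrite -expR0 ler_expR oppr_le0.
have p01 : 0 < p0 <= 1.
  case/andP: pmf01 => h1 h2; rewrite /p0 exprn_gt0 //=.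
  by apply: exprn_ile1 => //; exact: ltW.
exists (1 - p0); first by lra.
move=> K.
pose A r := [set w | forall s : 'I_n.+1, sil (sigma (r * n.+1 + s)%N) w].
have mA r : measurable (A r) by apply: measurable_forall => s; exact: msil.
have hA t : uniq t -> P (\bigcap_(r in [set` t]) A r) = (\prod_(r <- t) p0)%:E.
  move=> ut.
  pose sites := [seq sigma (r * n.+1 + s)%N | r <- t, s <- iota 0 n.+1].
  have -> : \bigcap_(r in [set` t]) A r = \bigcap_(i in [set` sites]) sil i.
    apply/seteqP; split=> w h.
      move=> i /= /allpairsP[[r s] [rt + ->]]; rewrite mem_iota add0n => /= sn.
      exact: (h r rt (Ordinal sn)).
    move=> r rt s; apply: h; apply/allpairsP; exists (r, s : nat).
    by rewrite mem_iota add0n ltn_ord.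
  rewrite (independent_bells0 hI) //; last first.
    apply: allpairs_uniq; [by []|exact: iota_uniq|].
    move=> [r s] [r' s'] /allpairsP[[r1 s1] [_ h1 [e1 e2]]]
      /allpairsP[[r2 s2] [_ h2 [e3 e4]]] /= /sinj e.
    subst; move: h1 h2; rewrite !mem_iota !add0n /= => h1 h2.
    have er : r1 = r2.
      by have := congr1 (divn^~ n.+1) e; rewrite !divnMDl // !divn_small // !addn0.
    by subst; congr pair; move/eqP: e; rewrite eqn_add2l => /eqP.
  rewrite big_allpairs_dep.
  under eq_bigr do under eq_bigr do rewrite Psil.
  rewrite -prodEFin; apply: eq_bigr => r _.
  by rewrite prodEFin big_const_seq count_predT size_iota -Monoid.iteropE.
have e : [set w | forall r : 'I_K, exists s : 'I_n.+1,
      (0 < N (sigma (r * n.+1 + s)) U w - N (sigma (r * n.+1 + s)) 0%R w)%N] =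
      \bigcap_(r in [set` iota 0 K]) ~` A r `&` \bigcap_(r in [set` [::]]) A r.
  apply/seteqP; split=> w /= h.
    split=> // r /=; rewrite mem_iota add0n => /= rK h'.
    have [s] := h (Ordinal rK); have := h' s; rewrite /sil /= => ->.
    by rewrite ltnn.
  move=> r; have [h' _] := h; apply: contrapT => hno.
  apply: (h' r); first by rewrite /= mem_iota add0n ltn_ord.
  move=> s; apply/eqP; rewrite /sil /= -leqn0 leqNgt; apply/negP => h''.
  by apply: hno; exists s.
rewrite e; split.
  apply: measurableI; first by apply: bigcap_seq_measurable => i; exact: measurableC.
  exact: bigcap_seq_measurable.
rewrite (independent_complements mA hA) ?cats0 ?iota_uniq // big_nil mulr1 lee_fin.
by rewrite big_const_seq count_predT size_iota -Monoid.iteropE.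
Qed.

End Line.

Section IntegerWindow.
Variable L : nat.
Local Notation M := ((2 * L).+1)%N.
Implicit Types a : 'I_M.

(** The cycle is cut open and centred at 0, so that [next_int] and [ordS] differ only across the
    cut. *)
Definition window_site (a : 'I_((2 * L).+1)%N) : int := (a : nat)%:Z - L%:Z.

Lemma window_site_inj : injective window_site.
Proof. by move=> a b; rewrite /window_site => h; apply/val_inj => /=; lia. Qed.

Lemma window_site_ex (i : int) : (- L%:Z <= i <= L%:Z) -> exists a, window_site a = i.
Proof.
move=> hi; have lt : (absz (i + L%:Z)%R < (2 * L).+1)%N by lia.
by exists (Ordinal lt); rewrite /window_site /=; lia.
Qed.

Lemma val_iter_ordS a r : (r <= L)%N ->
  (iter r (@ordS M) a : nat) = if (a + r < M)%N then (a + r)%N else (a + r - M)%N.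
Proof.
elim: r => [|r IH] rL /=; first by rewrite addn0 ltn_ord.
rewrite IH; last exact: ltnW.
have := ltn_ord a; move=> aM.
case: ifP => h.
  have [h'|h'] := ltnP (a + r.+1)%N ((2 * L).+1)%N.
    by rewrite modn_small; lia.
  have -> : ((a + r).+1 = (2 * L).+1)%N by lia.
  by rewrite modnn; lia.
by rewrite modn_small; [case: ifP; lia|lia].
Qed.

Lemma val_ord_pred a : (ord_pred a : nat) = if (a : nat) == 0%N then (2 * L)%N else a.-1.
Proof.
have := ltn_ord a; rewrite /= => aM; case: eqP => [->|a0].
  by rewrite add0n /= modn_small.
have -> : ((a + (2 * L).+1).-1 = a.-1 + (2 * L).+1)%N by lia.
by rewrite modnDr modn_small; lia.
Qed.

Lemma iter_next_int i r : iter r next_int i = i + r%:Z.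
Proof. by elim: r => [|r IH]; rewrite ?addr0 //= IH /next_int; lia. Qed.

Variables (n : nat) (lft rgt : int).
Hypotheses (hl : - L%:Z <= lft) (hlr : lft + n%:Z < rgt) (hr : rgt + n%:Z <= L%:Z).

(* Here the sites lft, ..., lft + n and rgt, ..., rgt + n are silent. *)
Definition window (a : 'I_((2 * L).+1)%N) : Prop :=
  lft + n%:Z <= window_site a < rgt + n%:Z.

(** A bell at i touches only $i-1,\dots,i+n$. Strictly between the two blocks this range lies in the
    window, beyond them outside it. A ring that crosses the cut of the cycle stays so close to it
    that the bounds on [L] keep it off the window. *)
Lemma window_shielded k (i : int) : (k <= n)%N ->
  ~ (lft <= i <= lft + n%:Z) -> ~ (rgt <= i <= rgt + n%:Z) ->
  shielded next_int prev_int n window_site window k i.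
Proof.
move=> kn nl nr.
have [/andP[h1 h2]|hi] := boolP (lft + n%:Z < i < rgt).
  have [|a ea] := @window_site_ex i; first by lia.
  left; exists a; rewrite -ea; apply: inner_bellP => //; first exact: window_site_inj.
  move=> r rn c.
  have ec : (c : nat) = (a + r)%N.
    rewrite /c val_iter_ordS; last by lia.
    by case: ifP => //; move: ea; rewrite /window_site; lia.
  have ep : (ord_pred c : nat) = (a + r).-1.
    rewrite val_ord_pred ec; case: eqP => //.
    by move: ea; rewrite /window_site; lia.
  move: ea; rewrite iter_next_int /window /prev_int /window_site ep ec => ea.
  by split; lia.
right; apply: outer_bellP => // [r a rn|a ea r rn].
  by rewrite iter_next_int /window /prev_int => Wa; split; lia.
have := ltn_ord a => aM.
have ec : (iter r (@ordS M) a : nat) = if (a + r < M)%N then (a + r)%N else (a + r - M)%N.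
  by apply: val_iter_ordS; lia.
move: ea; rewrite /window /window_site val_ord_pred ec => ea.
split.
  by case: ifP; lia.
by do ?[case: ifP => ?]; lia.
Qed.

End IntegerWindow.

Definition right_site (K0 j : nat) : int := (K0 + 1 + j)%N%:Z.
Definition left_site (K0 j : nat) : int := - (K0 + 1 + j)%N%:Z.

Lemma right_site_inj K0 : injective (right_site K0).
Proof. by move=> i j; rewrite /right_site; lia. Qed.

Lemma left_site_inj K0 : injective (left_site K0).
Proof. by move=> i j; rewrite /left_site; lia. Qed.

Lemma silent_blocks_shield (n k K0 o1 o2 o : nat) (c : int -> nat) :
  (k <= n)%N -> (o1 <= o)%N -> (o2 <= o)%N ->
  (forall s, (s <= n)%N -> c (right_site K0 (o1 + s)) = 0%N) ->
  (forall s, (s <= n)%N -> c (left_site K0 (o2 + s)) = 0%N) ->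
  exists W, (forall a, - K0%:Z <= @window_site (K0 + 1 + o + n) a <= K0%:Z -> W a) /\
    forall i, (0 < c i)%N ->
      shielded next_int prev_int n (@window_site (K0 + 1 + o + n)) W k i.
Proof.
move=> kn o1o o2o h1 h2; pose rgt : int := (K0 + 1 + o1)%N%:Z.
pose lft : int := - (K0 + 1 + o2 + n)%N%:Z.
exists (@window (K0 + 1 + o + n) n lft rgt); split.
  by move=> a; rewrite /window /lft /rgt; lia.
move=> i ci; apply: window_shielded => //.
- by rewrite /lft; lia.
- by rewrite /lft /rgt; lia.
- by rewrite /rgt; lia.
- rewrite /lft => hi; move: ci.
  have [s sn ->] : exists2 s, (s <= n)%N & i = left_site K0 (o2 + s).
    by exists (absz (- i - (K0 + 1 + o2)%N%:Z)%R); rewrite /left_site; lia.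
  by rewrite h2.
- rewrite /rgt => hi; move: ci.
  have [s sn ->] : exists2 s, (s <= n)%N & i = right_site K0 (o1 + s).
    by exists (absz (i - (K0 + 1 + o1)%N%:Z)%R); rewrite /right_site; lia.
  by rewrite h1.
Qed.

Lemma exp_small (R : realType) (x eps : R) : 0 <= x < 1 -> 0 < eps ->
  exists K, x ^+ K <= eps.
Proof.
move=> /andP[x0 x1] eps0.
have : `|x| < 1 by rewrite ger0_norm.
move=> /cvg_expr /cvgrPdist_le /(_ _ eps0) [K _ hK]; exists K.
by have := hK K (leqnn K); rewrite /= sub0r normrN ger0_norm // exprn_ge0.
Qed.

Section IntegerLine.
Context {R : realType} {d : measure_display} {T : measurableType d}.
Variable P : probability T R.
Variables (n : nat) (N : int -> R -> T -> nat) (X : R -> T -> int * 'I_n -> bool).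
Variables (rho : 'I_n -> R) (m : 'I_n).

(** The cycle must be the same for all w, since probabilities of its cells are summed, whereas the
    silent blocks are random. So the cycle has room for all candidate blocks, and only [W] depends
    on w. *)
Lemma localizable_int : is_multiline P next_int prev_int N X ->
  product_initial P rho (X 0) -> localizable P next_int prev_int N X m.
Proof.
move=> hX hrho U J eps U0 eps0.
have [B0 [mB0 PB0 good]] := exceptional_set hX.
case: (hX) => hN mX hI _.
pose K0 := (\sum_(j <- J) `|j|)%N.
have hJ j : j \in J -> - K0%:Z <= j <= K0%:Z.
  move=> jJ; have : (`|j| <= K0)%N by rewrite /K0 (big_rem j) //= leq_addr.
  by clear; lia.
have [x x01 hx] := no_silent_block n U0 hN hI (@right_site_inj K0).
have [y y01 hy] := no_silent_block n U0 hN hI (@left_site_inj K0).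
have [K1 hK1] := exp_small x01 (ltac:(lra) : 0 < eps / 2).
have [K2 hK2] := exp_small y01 (ltac:(lra) : 0 < eps / 2).
(* [K1] candidate blocks on the right and [K2] on the left; the sum bounds both, and the last n
   leaves room for the end of a block. *)
pose L := (K0 + 1 + (K1 + K2) * n.+1 + n)%N.
have [mR PR] := hx K1; have [mL PL] := hy K2.
set BR := [set w | _] in mR PR; set BL := [set w | _] in mL PL.
have mBB : measurable (BR `|` BL) by exact: measurableU.
exists (2 * L).+1, (@window_site L), (B0 `|` (BR `|` BL)); split.
- exact: window_site_inj.
- split; first exact: measurableU.
  apply: (le_trans (measureU2 _ _ _)) => //.
  rewrite [X in (X + _)%E]PB0 add0e.
  apply: (le_trans (measureU2 _ _ _)) => //.
  have -> : eps = eps / 2 + eps / 2 by lra.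
  rewrite EFinD; apply: leeD.
    by apply: (le_trans PR); rewrite lee_fin.
  by apply: (le_trans PL); rewrite lee_fin.
- move=> j /hJ hj; apply: window_site_ex.
  by rewrite /L; move: hj; clear; lia.
- move=> c a; apply: (config_law_jump _ hrho); last exact: window_site_inj.
  by move=> z; exact: mX.
move=> w nB.
have nB0 : ~ B0 w by move=> h; apply: nB; left.
have [_ hc] := good w nB0.
have [r1 h1] : exists r : 'I_K1, forall s : 'I_n.+1, N (right_site K0 (r * n.+1 + s)) U w = 0%N.
  apply: contrapT => hno; apply: nB; right; left => r.
  apply: contrapT => hno'; apply: hno; exists r => s.
  apply/eqP; rewrite -leqn0 leqNgt; apply/negP => h; apply: hno'; exists s.
  by case: (hc (right_site K0 (r * n.+1 + s))) => -> _ _; rewrite subn0.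
have [r2 h2] : exists r : 'I_K2, forall s : 'I_n.+1, N (left_site K0 (r * n.+1 + s)) U w = 0%N.
  apply: contrapT => hno; apply: nB; right; right => r.
  apply: contrapT => hno'; apply: hno; exists r => s.
  apply/eqP; rewrite -leqn0 leqNgt; apply/negP => h; apply: hno'; exists s.
  by case: (hc (left_site K0 (r * n.+1 + s))) => -> _ _; rewrite subn0.
have [|||||W [WJ Wsh]] := @silent_blocks_shield n m.+1 K0 (r1 * n.+1) (r2 * n.+1)
  ((K1 + K2) * n.+1) (fun i => N i U w).
- exact: ltn_ord.
- by rewrite leq_mul2r (leq_trans (ltnW (ltn_ord r1)) (leq_addr _ _)) orbT.
- by rewrite leq_mul2r (leq_trans (ltnW (ltn_ord r2)) (leq_addl _ _)) orbT.
- by move=> s sn; exact: (h1 (Ordinal (sn : (s < n.+1)%N))).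
- by move=> s sn; exact: (h2 (Ordinal (sn : (s < n.+1)%N))).
- by exists W; split=> // a /hJ; exact: WJ.
Qed.

End IntegerLine.

Theorem proposition3p2 (R : realType) (n : nat) (hn : (0 < n)%N) :
  (forall (N : nat) (q : 'I_n -> nat),
     (0 < N)%N -> (forall m, (q m <= N)%N) ->
     forall (d : measure_display) (T : measurableType d) (P : probability T R)
       (bells : 'I_N -> R -> T -> nat) (X : R -> T -> 'I_N * 'I_n -> bool),
       is_multiline P (@ordS N) (@ord_pred N) bells X ->
       uniform_initial P q (X 0) ->
       forall m : 'I_n, has_tasep_law (@ord_pred N) P (line_process X m)) /\
  (forall rho : 'I_n -> R,
     (forall m, 0 <= rho m <= 1) ->
     forall (d : measure_display) (T : measurableType d) (P : probability T R)
       (bells : int -> R -> T -> nat) (X : R -> T -> int * 'I_n -> bool),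
       is_multiline P next_int prev_int bells X ->
       product_initial P rho (X 0) ->
       forall m : 'I_n, has_tasep_law prev_int P (line_process X m)).
Proof.
split=> [N q _ _ d T P bells X hX hq m|rho _ d T P bells X hX hrho m].
  apply: (localizable_tasep_law (@ordSK N) hX).
  exact: localizable_cycle hq.
apply: (localizable_tasep_law _ hX); first by move=> i; rewrite /next_int /prev_int addrK.
exact: localizable_int hX hrho.
Qed.
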